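(* The values $\{\eta^{(n)}\}_{n\ge 0}$ are algebraically independent over $\overline{\mathbb{Q}}$, implying that $\eta^{(n)}$ is transcendental for all integers $n\ge 0$.
   Context: For integers $n\ge 0$, the generalized Eta constants are $$\eta^{(n)}=-n!\sum_{k=1}^{\infty}\frac{(-1)^k}{k^n\cdot k!}.$$ $\overline{\mathbb{Q}}$ denotes the field of algebraic numbers. Algebraic independence of the infinite family means that every finite subfamily is algebraically independent. *)

(* Defs.v *)
From mathcomp Require Import all_boot all_order all_algebra.
From mathcomp Require Import all_classical all_reals all_analysis.
From mathcomp Require Import complex.
(* The notations of mpoly clash with those of MathComp-Analysis. *)
From mathcomp Require Import -(notations) mpoly.

Set Implicit Arguments.
Unset Strict Implicit.
Unset Printing Implicit Defensive.

Import Order.TTheory GRing.Theory Num.Theory.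
Import numFieldNormedType.Exports.
Local Open Scope ring_scope.
Local Open Scope complex_scope.
Local Open Scope classical_set_scope.

Definition eta_const (R : realType) (n : nat) : R :=
  - n`!%:R * \big[+%R/(0 : R)]_(1 <= k <oo) ((-1) ^+ k / (k%:R ^+ n * k`!%:R)).

Definition Qbar (R : realType) : set R[i] :=
  [set z | algebraicOver (ratr : rat -> R[i]) z].

Definition transcendental (R : realType) (z : R[i]) : Prop := ~ Qbar z.

(* K stands for a subfield of L. A finite subfamily of x is given by an
   injective choice of m indices; the polynomials in m variables over K are
   those in {mpoly L[m]} whose coefficients all lie in K. *)
Definition algebraically_independent (L : fieldType) (K : set L)
    (I : Type) (x : I -> L) : Prop :=
  forall (m : nat) (f : 'I_m -> I), injective f ->
  forall p : mpoly m L, (forall e : multinom m, K (mcoeff e p)) ->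
  meval (x \o f) p = 0 -> p = 0.

(* Main.v *)
(* Let f = e^(-z) and g_j = sum_(k >= 1) (-z)^k / (k^j k!), so that eta^(n) is an
   affine function with rational coefficients of g_n(1), or of f(1) when n = 0.
   For delta = z d/dz one has delta f = - z f, delta g_1 = f - 1 and
   delta g_(j+1) = g_j, hence the N monomials h_i of degree at most D in these
   functions satisfy delta h_i = lam_i z h_i + sum_j A_ij h_j, where A is a constant
   strictly triangular matrix.

   As in the method of Siegel and Shidlovskii, the pigeonhole principle provides
   polynomials P_i of degree at most n with small integer coefficients for which
   sum_i P_i h_i vanishes at 0 to an order close to N n, and applying delta
   repeatedly yields more such forms. The zero estimate is elementary here: a
   nonzero module of vectors of polynomials that is stable under a triangular
   connection contains a multiple of a constant eigenvector, which allows one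
   either to conclude that N successive forms are independent or to eliminate one
   of the h_i. So the determinant of N successive forms is a nonzero polynomial of
   degree close to N n with a zero at 0 of order close to N n; its order at 1 is
   small, and enough derived forms are independent at z = 1. Completing a rational
   linear relation between the h_i(1) by N - 1 of these forms gives a nonzero
   integer determinant of absolute value less than 1.

   An algebraic relation over Qbar is first replaced by its norm, which is a
   relation over Q. *)
Require Import Defs.
From mathcomp Require Import all_boot all_order all_algebra.
From mathcomp Require Import all_classical all_reals all_analysis.
From mathcomp Require Import complex.
From mathcomp Require Import perm separable ring lra zify.
From mathcomp Require Import -(notations) mpoly.
Local Open Scope ring_scope.
Local Open Scope complex_scope.
Local Open Scope classical_set_scope.

Set Implicit Arguments.
Unset Strict Implicit.
Unset Printing Implicit Defensive.

Import Order.TTheory GRing.Theory Num.Theory numFieldNormedType.Exports.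

(** * Polynomial vectors under a triangular connection *)

(** The derivation z d/dz suits the singularity at 0: derived forms keep integer coefficients, gain
    at most one degree per step, and the s-th coefficient of their series is only multiplied by s,
    so no order at 0 is lost. The zero estimate rests on a single fact: a rational function u with z
    u' = c z u + g is constant. Triangularity allows it to be applied to one component after
    another. The relation has to be rational because the lower bound 1 for the final determinant
    comes from its being a nonzero integer; hence the norm. The upper bound is a contest of
    factorials. A cofactor contains N - 2 rows of integers, each costing about n!, and the remainder
    costs n! / (S - K)!, where S - K = N n + N - 3 t and n is a multiple of t by at least 5. So (S -
    K)! outgrows n!^(N-1) by a factorial of order n - 3 t. All other factors, including the
    denominators lcm(1, ..., S), must be exponential in t, except for the t^(O(t)) caused by
    differentiation, and n / t is chosen to absorb that. *)

Definition eulerD (F : nzRingType) (p : {poly F}) : {poly F} := 'X * p^`().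

Section EulerD.
Variable F : comNzRingType.
Implicit Types p q : {poly F}.

Lemma coef_eulerD p s : (eulerD p)`_s = p`_s *+ s.
Proof. by rewrite coefXM coef_deriv; case: s. Qed.

Lemma eulerDD p q : eulerD (p + q) = eulerD p + eulerD q.
Proof. by rewrite /eulerD derivD mulrDr. Qed.

Lemma eulerDM p q : eulerD (p * q) = eulerD p * q + p * eulerD q.
Proof. rewrite /eulerD derivM; ring. Qed.

Lemma eulerDZ c p : eulerD (c *: p) = c *: eulerD p.
Proof. by rewrite /eulerD derivZ scalerAr. Qed.

Lemma eulerD0 : eulerD 0 = 0 :> {poly F}.
Proof. by rewrite /eulerD deriv0 mulr0. Qed.

Lemma eulerD_sum (I : Type) (r : seq I) (P : pred I) (f : I -> {poly F}) :
  eulerD (\sum_(i <- r | P i) f i) = \sum_(i <- r | P i) eulerD (f i).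
Proof. by rewrite (big_morph _ eulerDD eulerD0). Qed.

Lemma eulerDXn s : eulerD 'X^s = s%:R *: 'X^s :> {poly F}.
Proof.
by apply/polyP => k; rewrite coef_eulerD coefZ coefXn; case: eqP => [->|_];
  rewrite ?mulr1 // mulr0 mul0rn.
Qed.

Lemma size_eulerD p : (size (eulerD p) <= size p)%N.
Proof. by apply/leq_sizeP => j jp; rewrite coef_eulerD nth_default // mul0rn. Qed.

End EulerD.

(** * Rational solutions of z u' = c z u + g *)

Section ConstantQuotient.
Variable F : numFieldType.
Implicit Types x y : {poly F}.

Lemma poly_XnP x : x != 0 -> exists s x1, x1.[0] != 0 /\ x = 'X^s * x1.
Proof.
move=> x0; have [m [q /implyP/(_ x0) q0 ->]] := multiplicity_XsubC x 0.
by exists m, q; rewrite subr0 mulrC.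
Qed.

(** Orders at 0 decide. With x = X^s x1 and y = X^p y1, the terms other than [g y^2] add up to
    X^(s+p) times a polynomial with value (s - p) x1(0) y1(0) at 0, while [g y^2] has order 2 p
    unless [g = 0]. Both s < p and s > p are contradictory, and for s = p the value at 0 is zero,
    which kills [g]. *)
Lemma quotient_order x y (c g : F) : x != 0 -> y != 0 ->
  y * eulerD x - x * eulerD y = c *: ('X * x * y) + g *: y ^+ 2 ->
  exists p x1 y1, [/\ x1.[0] != 0, y1.[0] != 0, x = 'X^p * x1, y = 'X^p * y1 & g = 0].
Proof.
move=> /poly_XnP[s [x1 [x10 ->]]] /poly_XnP[p [y1 [y10 ->]]].
rewrite !eulerDM !eulerDXn -!mul_polyC => E.
have e0 (q : {poly F}) : (eulerD q).[0] = 0 by rewrite /eulerD hornerM hornerX mul0r.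
have Xn0 n : 'X^n != 0 :> {poly F} by rewrite monic_neq0 ?monicXn.
have E1 : 'X^(s + p) * ((s%:R - p%:R)%:P * x1 * y1 + y1 * eulerD x1 - x1 * eulerD y1
    - c%:P * 'X * x1 * y1) = 'X^(p + p) * (g%:P * y1 ^+ 2).
  rewrite !exprD polyCB; move: E.
  move: (s%:R)%:P (p%:R)%:P 'X^s 'X^p (eulerD x1) (eulerD y1) => a b u v x2 y2 E.
  by move/eqP: E; rewrite -subr_eq0 => /eqP E; apply: subr0_eq; rewrite -[RHS]E; ring.
set w := _ - _ in E1.
have ew : w.[0] = (s%:R - p%:R) * x1.[0] * y1.[0].
  by rewrite !(hornerD, hornerN, hornerM, e0, hornerC, hornerX) !(mulr0, mul0r, subr0, addr0).
have eg : (g%:P * y1 ^+ 2).[0] = g * y1.[0] ^+ 2 by rewrite hornerM hornerC horner_exp.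
have eX n (q : {poly F}) : (0 < n)%N -> ('X^n * q).[0] = 0.
  by case: n => // n _; rewrite hornerM hornerXn expr0n mul0r.
have sp0 : w.[0] = 0 -> s = p.
  move=> /eqP; rewrite ew !mulf_eq0 (negPf x10) (negPf y10) !orbF.
  by rewrite subr_eq0 eqr_nat => /eqP.
case: (ltngtP s p) => sp.
- exfalso; have E2 : w = 'X^(p - s) * (g%:P * y1 ^+ 2).
    apply: (mulfI (Xn0 (s + p)%N)); rewrite E1 [RHS]mulrA -exprD; congr ('X^_ * _); lia.
  suff /sp0 e : w.[0] = 0 by move: sp; rewrite e ltnn.
  by rewrite E2 eX // subn_gt0.
- exfalso; have E2 : 'X^(s - p) * w = g%:P * y1 ^+ 2.
    apply: (mulfI (Xn0 (p + p)%N)); rewrite -E1 mulrA -exprD; congr ('X^_ * _); lia.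
  have g0 : g = 0.
    move/(congr1 (horner^~ 0)): (E2); rewrite eg eX ?subn_gt0 // => /esym/eqP.
    by rewrite mulf_eq0 expf_eq0 (negPf y10) orbF => /eqP.
  move: E2; rewrite g0 mul0r => /eqP; rewrite mulf_eq0 (negPf (Xn0 _)) /= => /eqP w0.
  suff /sp0 e : w.[0] = 0 by move: sp; rewrite e ltnn.
  by rewrite w0 horner0.
- exists p, x1, y1; split => //; first by rewrite sp.
  move: E1; rewrite {1}sp => /(mulfI (Xn0 _)) /(congr1 (horner^~ 0)).
  rewrite eg ew sp subrr !mul0r => /esym/eqP.
  by rewrite mulf_eq0 expf_eq0 (negPf y10) orbF => /eqP.
Qed.

(* The quotient u = x / y satisfies z u' = c z u + g. *)
Lemma quotient_const x y (c g : F) : y != 0 ->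
  y * eulerD x - x * eulerD y = c *: ('X * x * y) + g *: y ^+ 2 ->
  [/\ g = 0, c = 0 \/ x = 0 & exists k, x = k *: y].
Proof.
move=> y0 E; case: (eqVneq x 0) => [x0|x0].
  split; [|by right|by exists 0; rewrite scale0r].
  move: E; rewrite x0 eulerD0 mulr0 mul0r subr0 mulr0 mul0r scaler0 add0r.
  by move/esym/eqP; rewrite scaler_eq0 expf_eq0 (negPf y0) orbF => /eqP.
have [p [x1 [y1 [x10 y10 Ex Ey g0]]]] := quotient_order x0 y0 E.
(* Degrees: a nonzero [c] would give the right side degree deg x + deg y + 1, one more than the left
   side can reach. *)
have c0 : c = 0.
  apply/eqP; apply: contraT => c0.
  have sX : size ('X : {poly F}) = 2%N by rewrite size_polyX.
  move: E; rewrite g0 scale0r addr0 => /(congr1 (size \o val)) /=.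
  rewrite size_scale // -mulrA !size_mul ?mulf_neq0 ?polyX_eq0 // sX => E.
  have : (size (y * eulerD x - x * eulerD y)%R <= (size x + size y).-1)%N.
    rewrite (leq_trans (size_polyD _ _)) // size_polyN geq_max.
    apply/andP; split; apply: (leq_trans (size_polyMleq _ _)).
      by rewrite addnC -!subn1 leq_sub2r // leq_add2r size_eulerD.
    by rewrite -!subn1 leq_sub2r // leq_add2l size_eulerD.
  rewrite E; move: (x0) (y0); rewrite -!size_poly_gt0; case: (size x) => // a.
  by case: (size y) => // b; rewrite /= ltnn.
split=> //; first by left.
(* The scalar k is the ratio of the lowest coefficients. If x - k y were nonzero, it would satisfy
   the same equation with [c = g = 0] and so have the order of [y] at 0, but its coefficient of that
   order is zero. *)
exists (x1.[0] / y1.[0]); apply/eqP; rewrite -subr_eq0; apply: contraT => w0.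
have Ew : y * eulerD (x - (x1.[0] / y1.[0]) *: y) - (x - (x1.[0] / y1.[0]) *: y) * eulerD y
   = 0 *: ('X * (x - (x1.[0] / y1.[0]) *: y) * y) + 0 *: y ^+ 2.
  rewrite !scale0r addr0 -scaleNr eulerDD eulerDZ -!mul_polyC.
  by move: E; rewrite c0 g0 !scale0r addr0 => E; rewrite -[RHS]E; ring.
have [p' [w1 [y1' [w10 y10' Ew1 Ey' _]]]] := quotient_order w0 y0 Ew.
have Xn0 n : 'X^n != 0 :> {poly F} by rewrite monic_neq0 ?monicXn.
have pp : p = p'.
  apply/eqP; move: Ey'; rewrite Ey; case: ltngtP => // lp /(congr1 (fun a : {poly F} => a`_(minn p p'))).
    rewrite !coefXnM (minn_idPl (ltnW lp)) ltnn lp subnn => /eqP.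
    by rewrite -horner_coef0 (negPf y10).
  rewrite !coefXnM (minn_idPr (ltnW lp)) ltnn lp subnn => /esym/eqP.
  by rewrite -horner_coef0 (negPf y10').
move: Ew1; rewrite Ex Ey -pp -mul_polyC => Ew1.
have : x1 - (x1.[0] / y1.[0])%:P * y1 = w1 by apply: (mulfI (Xn0 p)); rewrite -Ew1; ring.
by move/(congr1 (horner^~ 0)); rewrite !hornerE divfK // subrr => /esym/eqP; rewrite (negPf w10).
Qed.

End ConstantQuotient.
(** With [mu = lam] and [B = A^T] this is the action of z d/dz on the coefficients of a form sum_i
    q_i h_i. With [- lam] and [- A] it is the dual connection, for which the pairing of two vectors
    obeys the Leibniz rule. *)
Definition connection (F : nzRingType) (N : nat) (mu : 'I_N -> F) (B : 'M[F]_N)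
    (q : 'rV[{poly F}]_N) : 'rV[{poly F}]_N :=
  \row_i (eulerD (q 0 i) + mu i *: ('X * q 0 i) + \sum_j B i j *: q 0 j).

Section ConstantEigenvector.
Variables (F : numFieldType) (N : nat) (mu : 'I_N -> F) (B : 'M[F]_N).
Variables (rho : 'I_N -> nat).
Hypothesis rho_inj : injective rho.
Hypothesis tri : forall i j, B i j != 0 -> (rho j < rho i)%N.
Implicit Types q : 'rV[{poly F}]_N.

(** Take [q] in [W] whose first nonzero entry, in the order of [rho], comes as late as possible.
    Eliminating this entry between [q] and its derivative gives a vector of [W] whose first entry
    would come later, so it is 0. Hence the quotient of each entry by the first one satisfies an
    equation as in [quotient_const]. *)
Lemma stable_const_eigenvector (W : 'rV[{poly F}]_N -> Prop) :
  (forall a b q q', W q -> W q' -> W (a *: q + b *: q')) ->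
  (forall q, W q -> W (connection mu B q)) ->
  (exists2 q, W q & q != 0) ->
  exists (c : 'rV[F]_N) (y : {poly F}) (m : F),
    [/\ c != 0, y != 0, W (y *: map_mx polyC c),
        forall i, c 0 i = 0 \/ mu i = m & forall i, \sum_j B i j * c 0 j = 0].
Proof.
move=> Wlin Wconn [q0 Wq0 q00].
pose lead q i := q 0 i != 0 /\ (forall j, (rho j < rho i)%N -> q 0 j = 0).
have leadP q : q != 0 -> exists i, lead q i.
  move=> /rV0Pn[i qi].
  have [j qj jmin] := @arg_minnP _ i (fun j => q 0 j != 0) rho qi.
  exists j; split=> // k kj; apply/eqP; apply: contraLR kj => qk.
  by rewrite -leqNgt jmin.
pose P n := `[< exists q i, [/\ W q, lead q i & rho i = n] >].
have exP : exists n, P n.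
  by have [i li] := leadP _ q00; exists (rho i); apply/asboolP; exists q0, i.
have bndP n : P n -> (n <= \sum_i rho i)%N.
  by move=> /asboolP[q [i [_ _ <-]]]; rewrite (bigD1 i) //= leq_addr.
have [n /asboolP[q [i [Wq [qi0 qlt] rn]]] nmax] := ex_maxnP exP bndP.
have Bq : \sum_j B i j *: q 0 j = 0.
  apply: big1 => j _; case: (eqVneq (B i j) 0) => [->|/tri /qlt ->].
    by rewrite scale0r.
  by rewrite scaler0.
pose q' := q 0 i *: connection mu B q - (eulerD (q 0 i) + mu i *: ('X * q 0 i)) *: q.
have Wq' : W q' by rewrite /q' -scaleNr; apply: Wlin => //; apply: Wconn.
have q'0 : q' = 0.
  apply/eqP; apply: contraT => /leadP[k [qk0 qklt]].
  have : (rho k <= n)%N by apply: nmax; apply/asboolP; exists q', k.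
  rewrite -rn => ki; case/eqP: qk0; rewrite /q' !mxE.
  case: (eqVneq (rho k) (rho i)) => [/rho_inj ->|ne].
    by rewrite Bq; ring.
  have lt_ki : (rho k < rho i)%N by rewrite ltn_neqAle ne.
  rewrite (qlt _ lt_ki) eulerD0 !mulr0 scaler0 !add0r big1 ?mulr0 ?subrr // => j _.
  case: (eqVneq (B k j) 0) => [->|/tri jk]; first by rewrite scale0r.
  by rewrite qlt ?scaler0 // (ltn_trans jk).
have eqj j : q 0 i * eulerD (q 0 j) - q 0 j * eulerD (q 0 i) =
    (mu i - mu j) *: ('X * q 0 j * q 0 i) - q 0 i * \sum_k B j k *: q 0 k.
  move: q'0 => /rowP /(_ j); rewrite !mxE -!mul_polyC polyCB => E.
  by apply: subr0_eq; rewrite -[RHS]E; ring.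
(* Induction along [rho]: the entries below [j] are already multiples of [q 0 i], so the sum over
   [B] is a scalar times [q 0 i], and this scalar provides the constant [g]. *)
have main j : exists2 k, q 0 j = k *: q 0 i & (k = 0 \/ mu j = mu i).
  have [d] := ubnP (rho j); elim: d j => // d IH j; rewrite ltnS => jd.
  have [u hu] : {u : 'I_N -> F & forall k, (rho k < rho j)%N -> q 0 k = u k *: q 0 i}.
    apply: (choice (P := fun k uk => (rho k < rho j)%N -> q 0 k = uk *: q 0 i)) => k.
    case: (ltnP (rho k) (rho j)) => kj; last by exists 0.
    by have [v -> _] := IH k (leq_trans kj jd); exists v.
  have sB : \sum_k B j k *: q 0 k = (\sum_k B j k * u k) *: q 0 i.
    rewrite scaler_suml; apply: eq_bigr => k _.
    case: (eqVneq (B j k) 0) => [->|/tri /hu ->]; last by rewrite scalerA.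
    by rewrite mul0r !scale0r.
  have [|_ cx [k kq]] := @quotient_const F (q 0 j) (q 0 i) (mu i - mu j)
    (- \sum_k B j k * u k) qi0.
    by rewrite eqj sB -!mul_polyC polyCN; ring.
  exists k => //; case: cx => [/subr0_eq->|]; first by right.
  by rewrite kq => /eqP; rewrite scaler_eq0 (negPf qi0) orbF => /eqP; left.
have [c hc] : {c : 'I_N -> F & forall j, q 0 j = c j *: q 0 i /\ (c j = 0 \/ mu j = mu i)}.
  by apply: (choice (P := fun j cj => q 0 j = cj *: q 0 i /\ (cj = 0 \/ mu j = mu i)))
    => j; have [k] := main j; exists k.
exists (\row_j c j), (q 0 i), (mu i); split => //.
- apply/rV0Pn; exists i; rewrite mxE; apply/eqP => ci0.
  by case: (hc i); rewrite ci0 scale0r => qi; move: qi0; rewrite qi eqxx.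
- suff -> : q 0 i *: map_mx polyC (\row_j c j) = q by [].
  by apply/rowP => j; rewrite !mxE (hc j).1 mulrC mul_polyC.
- by move=> j; rewrite mxE; exact: (hc j).2.
- move=> j; have := eqj j; rewrite (hc j).1 eulerDZ.
  have -> : \sum_k B j k *: q 0 k = (\sum_k B j k * c k) *: q 0 i.
    by rewrite scaler_suml; apply: eq_bigr => k _; rewrite (hc k).1 scalerA.
  have -> : (mu i - mu j) *: ('X * (c j *: q 0 i) * q 0 i) = 0.
    by case: (hc j).2 => ->; rewrite ?scale0r ?mulr0 ?mul0r ?scaler0 // subrr scale0r.
  rewrite -!mul_polyC => E; apply/eqP.
  have: (\sum_k B j k * c k)%:P * q 0 i ^+ 2 = 0.
    by move: E => /eqP; rewrite -subr_eq0 => /eqP E; rewrite -[RHS]E; ring.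
  move/eqP; rewrite mulf_eq0 expf_eq0 (negPf qi0) orbF polyC_eq0.
  by congr (_ == _); apply: eq_bigr => k _; rewrite mxE.
Qed.

End ConstantEigenvector.

(** * Iterated connections and Krylov matrices *)

Section ConnectionTheory.
Variables (F : comNzRingType) (N : nat) (mu : 'I_N -> F) (B : 'M[F]_N).
Implicit Types (p q : 'rV[{poly F}]_N) (a : {poly F}).

Lemma connectionD p q :
  connection mu B (p + q) = connection mu B p + connection mu B q.
Proof.
apply/rowP => i; rewrite !mxE eulerDD mulrDr scalerDr.
have -> : \sum_j B i j *: (p + q) 0 j = \sum_j B i j *: p 0 j + \sum_j B i j *: q 0 j.
  by rewrite -big_split; apply: eq_bigr => j _; rewrite mxE scalerDr.
ring.
Qed.

Lemma connectionZ a q :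
  connection mu B (a *: q) = eulerD a *: q + a *: connection mu B q.
Proof.
apply/rowP => i; rewrite !mxE eulerDM !mulrDr -!addrA; congr (_ + (_ + (_ + _))).
  by rewrite -scalerAr mulrCA.
by rewrite mulr_sumr; apply: eq_bigr => j _; rewrite mxE scalerAr.
Qed.

Lemma connection0 : connection mu B 0 = 0.
Proof.
by apply/rowP => i; rewrite !mxE eulerD0 mulr0 scaler0 !add0r big1 // => j _; rewrite mxE scaler0.
Qed.

Lemma connection_sum (I : Type) (r : seq I) (P : pred I) (f : I -> 'rV[{poly F}]_N) :
  connection mu B (\sum_(i <- r | P i) f i) = \sum_(i <- r | P i) connection mu B (f i).
Proof. exact: (big_morph _ connectionD connection0). Qed.

Lemma size_connection n q : (forall i, (size (q 0%R i) <= n)%N) ->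
  forall i, (size (connection mu B q 0%R i) <= n.+1)%N.
Proof.
move=> qn i; rewrite mxE; apply/leq_sizeP => j nj.
have q0 k : (q 0 k)`_j = 0 by rewrite nth_default // (leq_trans (qn k)) // ltnW.
rewrite !coefD coef_eulerD coefZ coefXM coef_sum q0 mul0rn add0r.
case: j nj q0 => // j nj q0 /=; rewrite nth_default ?mulr0 ?add0r ?(leq_trans (qn i)) //.
by rewrite big1 // => k _; rewrite coefZ q0 mulr0.
Qed.

Lemma size_iter_connection n k q : (forall i, (size (q 0%R i) <= n)%N) ->
  forall i, (size (iter k (connection mu B) q 0%R i) <= n + k)%N.
Proof.
by elim: k => [|k IH] qn i; rewrite ?addn0 ?addnS //=; apply: size_connection; apply: IH.
Qed.

End ConnectionTheory.

Definition krylov (F : nzRingType) (N : nat) (mu : 'I_N -> F) (B : 'M[F]_N)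
    (q : 'rV[{poly F}]_N) : 'M[{poly F}]_N :=
  \matrix_(k, j) iter k (connection mu B) q 0 j.

Lemma size_prod_bound (F : nzRingType) (I : Type) (r : seq I) (P : pred I)
    (f : I -> {poly F}) (d : I -> nat) : (forall i, (size (f i) <= (d i).+1)%N) ->
  (size (\prod_(i <- r | P i) f i)%R <= (\sum_(i <- r | P i) d i).+1)%N.
Proof.
move=> fd; elim/big_rec2: _ => [|i y p _ IH]; first by rewrite size_poly1.
apply: leq_trans (size_polyMleq _ _) _; rewrite -subn1 leq_subLR add1n -addSn -addnS.
exact: leq_add.
Qed.

Lemma size_det_bound (F : comNzRingType) (N : nat) (M : 'M[{poly F}]_N) (d : 'I_N -> nat) :
  (forall i j, (size (M i j) <= (d i).+1)%N) -> (size (\det M) <= (\sum_i d i).+1)%N.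
Proof.
move=> Md; apply: (leq_trans (size_sum _ _ _)); apply/bigmax_leqP => s _.
rewrite -signr_odd; case: (odd _); rewrite ?expr1 ?expr0 ?mulN1r ?mul1r ?size_polyN;
  exact: size_prod_bound.
Qed.

Section KrylovDegenerate.
Variables (F : numFieldType) (N : nat) (lam : 'I_N -> F) (A : 'M[F]_N).
Variables (rho : 'I_N -> nat).
Hypothesis rho_inj : injective rho.
Hypothesis tri : forall i j, A i j != 0 -> (rho j < rho i)%N.
Local Notation nabla := (connection lam A^T).

Let dot (p q : 'rV[{poly F}]_N) := \sum_i p 0 i * q 0 i.

Let dotDl p p' q : dot (p + p') q = dot p q + dot p' q.
Proof. by rewrite -big_split; apply: eq_bigr => i _; rewrite mxE mulrDl. Qed.

Let dotZl a p q : dot (a *: p) q = a * dot p q.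
Proof. by rewrite mulr_sumr; apply: eq_bigr => i _; rewrite mxE mulrA. Qed.

Let dot_suml (I : Type) (r : seq I) (P : pred I) f q :
  dot (\sum_(i <- r | P i) f i) q = \sum_(i <- r | P i) dot (f i) q.
Proof.
apply: (big_morph (dot^~ q)) => [p p'|]; first exact: dotDl.
by apply: big1 => i _; rewrite mxE mul0r.
Qed.

Let eulerD_dot p q : eulerD (dot p q) =
  dot (nabla p) q + dot p (connection (fun i => - lam i) (- A) q).
Proof.
rewrite eulerD_sum /dot.
rewrite [X in X + _](eq_bigr (fun i => eulerD (p 0 i) * q 0 i
   + lam i *: ('X * p 0 i * q 0 i) + \sum_j A j i *: (p 0 j * q 0 i))); last first.
  move=> i _; rewrite mxE !mulrDl mulr_suml; congr (_ + _ + _); first by rewrite -scalerAl.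
  by apply: eq_bigr => j _; rewrite mxE -scalerAl.
rewrite [X in _ + X](eq_bigr (fun i => p 0 i * eulerD (q 0 i)
   - lam i *: ('X * p 0 i * q 0 i) - \sum_j A i j *: (p 0 i * q 0 j))); last first.
  move=> i _; rewrite mxE !mulrDr mulr_sumr -sumrN; congr (_ + _ + _).
    by rewrite scaleNr mulrN -scalerAr mulrCA mulrA.
  by apply: eq_bigr => j _; rewrite mxE scaleNr mulrN -scalerAr.
rewrite !big_split /= sumrN [X in _ + _ + X]exchange_big /=.
rewrite !sumrN [X in _ - X](_ : _ = \sum_i \sum_j A i j *: (p 0 i * q 0 j)) //.
rewrite (eq_bigr (fun i => eulerD (p 0 i) * q 0 i + p 0 i * eulerD (q 0 i))); last first.
  by move=> i _; exact: eulerDM.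
rewrite big_split /=.
set a := \sum_i eulerD _ * _; set b := \sum_i _ * eulerD _.
set c := \sum_i lam i *: _; set d := \sum_i \sum_j _.
ring.
Qed.

(* Some nonzero vector annihilates the rows of the Krylov matrix, so the
   orthogonal of all the derivatives of p is a nonzero module stable under the
   dual connection. *)
Lemma det_krylov0 (p : 'rV[{poly F}]_N) : \det (krylov lam A^T p) = 0 ->
  exists (c : 'rV[F]_N) (m : F), [/\ c != 0, \sum_i c 0 i *: p 0 i = 0,
    forall i, c 0 i = 0 \/ lam i = m & forall i, \sum_j A i j * c 0 j = 0].
Proof.
pose pk k := iter k nabla p.
move/eqP/det0P => [v /rV0Pn[i0 vi0] vK].
have [r vr rmax] := @arg_maxnP _ i0 (fun i => v 0 i != 0) (@nat_of_ord N) vi0.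
(* [r] is the last index in the support of the kernel vector [v], so [v_r] times the r-th derivative
   depends on the earlier ones. Applying the connection carries this to all later derivatives with
   the same factor [v_r]. *)
have rel m : exists u : nat -> {poly F}, v 0 r *: pk (r + m)%N = \sum_(k < r + m) u k *: pk k.
  elim: m => [|m [u IH]].
    exists (fun k => if insub k is Some i then - v 0 i else 0); rewrite addn0.
    have -> : v 0 r *: pk r = - \sum_(i < N | (i < r)%N) v 0 i *: pk i.
      apply/eqP; rewrite -addr_eq0 addrC; apply/eqP; rewrite -[RHS]vK; apply/rowP => j.
      rewrite mxE summxE [RHS]mxE [RHS](bigID (fun i : 'I_N => (i < r)%N)) /=; congr (_ + _).
        by apply: eq_bigr => i _; rewrite !mxE.
      rewrite (bigD1 r) ?ltnn //= big1 ?addr0 ?mxE // => i /andP[].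
      rewrite -leqNgt leq_eqVlt eq_sym val_eqE => /orP[/eqP->|ri _]; first by rewrite eqxx.
      have [->|/rmax] := eqVneq (v 0 i) 0; first by rewrite mul0r.
      by rewrite /= leqNgt ri.
    rewrite -sumrN big_ord_narrow ?(ltnW (ltn_ord r)) // => le.
    apply: eq_bigr => i _; rewrite insubT ?(ltn_trans _ (ltn_ord r)) //= => iN.
    by rewrite scaleNr; congr (- (v 0 _ *: _)); apply/val_inj.
  have := congr1 nabla IH; rewrite connectionZ connection_sum addnS => E.
  exists (fun k => (if (k < r + m)%N then eulerD (u k) else - eulerD (v 0 r))
                   + (if k is k'.+1 then u k' else 0)).
  have -> : v 0 r *: pk (r + m).+1 = v 0 r *: nabla (pk (r + m)%N) by [].
  have -> : v 0 r *: nabla (pk (r + m)%N) =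
    \sum_(k < r + m) nabla (u k *: pk k) - eulerD (v 0 r) *: pk (r + m)%N.
    by rewrite -E [X in X - _]addrC addrK.
  rewrite [RHS](eq_bigr (fun k : 'I_(r + m).+1 =>
    (if (k < r + m)%N then eulerD (u k) else - eulerD (v 0 r)) *: pk k +
    (if nat_of_ord k is k'.+1 then u k' else 0) *: pk k)); last by move=> k _; rewrite scalerDl.
  rewrite big_split /= big_ord_recr /= ltnn scaleNr.
  rewrite [X in _ + _ + X]big_ord_recl /= scale0r add0r.
  rewrite (eq_bigr (fun k : 'I_(r + m) => eulerD (u k) *: pk k + u k *: pk k.+1)); last first.
    by move=> k _; rewrite connectionZ.
  rewrite big_split /= -!addrA; congr (_ + _).
    by apply: eq_bigr => k _; rewrite ltn_ord.
  by rewrite addrC.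
pose W q := forall k, dot (pk k) q = 0.
have [||||c [y [m [c0 y0 Wc cm cA]]]] := @stable_const_eigenvector F N (fun i => - lam i) (- A) rho rho_inj _ W.
- by move=> i j; rewrite mxE oppr_eq0; exact: tri.
- move=> a b q q' Wq Wq' k.
  have -> : dot (pk k) (a *: q + b *: q') = a * dot (pk k) q + b * dot (pk k) q'.
    by rewrite !mulr_sumr -big_split; apply: eq_bigr => i _ /=; rewrite !mxE; ring.
  by rewrite Wq Wq' !mulr0 addr0.
- move=> q Wq k; have := eulerD_dot (pk k) q; rewrite Wq eulerD0.
  by rewrite (Wq k.+1 : dot (nabla (pk k)) q = 0) add0r => <-.
(* The orthogonal is nonzero: by [rel] only the first r derivatives impose conditions, and r < N
   linear conditions have a nonzero common solution. *)
- pose K' : 'M[{poly F}]_N := \matrix_(k, j) if (k < r)%N then pk k 0 j else 0.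
  have : \det K'^T == 0.
    rewrite det_tr; apply/det0P; exists (delta_mx 0 r).
      by apply/rV0Pn; exists r; rewrite mxE !eqxx oner_neq0.
    by rewrite -rowE; apply/rowP => j; rewrite !mxE ltnn.
  case/det0P => q q0 qK; exists q => // k.
  have [d] := ubnP k; elim: d k => // d IH k; rewrite ltnS => kd.
  case: (ltnP k r) => kr.
    have kN := ltn_trans kr (ltn_ord r).
    move/rowP/(_ (Ordinal kN)): qK; rewrite !mxE => E; rewrite -[RHS]E.
    by apply: eq_bigr => i _; rewrite !mxE /= kr mulrC.
  have [u] := rel (k - r)%N; rewrite subnKC // => E.
  apply/eqP; move: (congr1 (dot^~ q) E); rewrite dotZl dot_suml big1 => [/eqP|i _].
    by rewrite mulf_eq0 (negPf vr).
  by rewrite dotZl IH ?mulr0 // (leq_trans _ kd).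
exists c, (- m); split=> //.
- have := Wc 0%N; rewrite /dot /= => E; apply: (mulfI y0); rewrite mulr0 -[RHS]E mulr_sumr.
  by apply: eq_bigr => i _; rewrite !mxE -mul_polyC; ring.
- by move=> i; case: (cm i) => [|<-]; [left|right; rewrite opprK].
- move=> i; apply/eqP; rewrite -oppr_eq0 -sumrN; apply/eqP; rewrite -[RHS](cA i).
  by apply: eq_bigr => j _; rewrite mxE mulNr.
Qed.

End KrylovDegenerate.
(** * The zero estimate *)

(** Power series are encoded as coefficient sequences, and this is the Cauchy product of a
    polynomial with a series, the product out of which linear forms are built. *)
Definition smul (F : nzRingType) (p : {poly F}) (h : nat -> F) : nat -> F :=
  fun s => \sum_(j < s.+1) p`_j * h (s - j)%N.

Section SeriesModule.
Variable F : comNzRingType.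
Implicit Types (p q : {poly F}) (h : nat -> F).

Lemma smulE T p h s : (s < T)%N -> smul p h s = (p * \poly_(k < T) h k)`_s.
Proof.
move=> sT; rewrite coefM; apply: eq_bigr => j _.
by rewrite coef_poly (leq_ltn_trans (leq_subr _ _) sT).
Qed.

Lemma smulDl p q h s : smul (p + q) h s = smul p h s + smul q h s.
Proof. by rewrite !(@smulE s.+1) // mulrDl coefD. Qed.

Lemma smul0l h s : smul 0 h s = 0.
Proof. by rewrite (@smulE s.+1) // mul0r coef0. Qed.

Lemma smul_suml (I : Type) (r : seq I) (P : pred I) (f : I -> {poly F}) h s :
  smul (\sum_(i <- r | P i) f i) h s = \sum_(i <- r | P i) smul (f i) h s.
Proof. by rewrite (@smulE s.+1) // mulr_suml coef_sum; apply: eq_bigr => i _; rewrite -smulE. Qed.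

Lemma smul_sumr (I : Type) (r : seq I) (P : pred I) (f : I -> nat -> F) p s :
  smul p (fun k => \sum_(i <- r | P i) f i k) s = \sum_(i <- r | P i) smul p (f i) s.
Proof. by rewrite exchange_big; apply: eq_bigr => j _; rewrite mulr_sumr. Qed.

Lemma smulZl c p h s : smul (c *: p) h s = c * smul p h s.
Proof. by rewrite !(@smulE s.+1) // -scalerAl coefZ. Qed.

Lemma smulNl p h s : smul (- p) h s = - smul p h s.
Proof. by rewrite !(@smulE s.+1) // mulNr coefN. Qed.

Lemma smulZr c p h s : smul p (fun k => c * h k) s = c * smul p h s.
Proof. by rewrite mulr_sumr; apply: eq_bigr => j _; rewrite mulrCA. Qed.

Lemma smulM p q h s : smul (p * q) h s = smul p (smul q h) s.
Proof.
rewrite (@smulE s.+1) // -mulrA coefM; apply: eq_bigr => j _.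
by rewrite (@smulE s.+1) // ltnS leq_subr.
Qed.

Lemma smul1 h s : smul 1 h s = h s.
Proof. by rewrite (@smulE s.+1) // mul1r coef_poly ltnSn. Qed.

Lemma smulX h s : smul 'X h s = if s is s'.+1 then h s' else 0.
Proof. by rewrite (@smulE s.+1) // coefXM; case: s => // s; rewrite coef_poly leqnSn. Qed.

Lemma eq_smulr p h h' s : (forall k, (k <= s)%N -> h k = h' k) -> smul p h s = smul p h' s.
Proof. by move=> hh; apply: eq_bigr => j _; rewrite hh // leq_subr. Qed.

Lemma smul_order0 p h S : (forall s, (s < S)%N -> h s = 0) ->
  forall s, (s < S)%N -> smul p h s = 0.
Proof.
by move=> h0 s sS; apply: big1 => j _; rewrite h0 ?mulr0 // (leq_ltn_trans (leq_subr _ _)).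
Qed.

Lemma smul_eulerD p h s :
  smul p h s *+ s = smul (eulerD p) h s + smul p (fun k => h k *+ k) s.
Proof.
rewrite -sumrMnl -big_split /=; apply: eq_bigr => j _; rewrite coef_eulerD mulrnAl mulrnAr.
by rewrite -mulrnDr subnKC // -ltnS.
Qed.

End SeriesModule.

(** The lowest nonzero coefficients of [p] and [h] multiply to a nonzero coefficient of the product,
    at an index at most size p - 1 + C. *)
Lemma smul_order (F : idomainType) (p : {poly F}) (h : nat -> F) S C :
  p != 0 -> (exists2 s, (s <= C)%N & h s != 0) ->
  (forall s, (s < S)%N -> smul p h s = 0) -> (S < size p + C)%N.
Proof.
move=> p0 [s1 s1C hs1] ph0.
have exh : exists s, h s != 0 by exists s1.
have exp : exists j, p`_j != 0.
  by exists (size p).-1; rewrite -lead_coefE lead_coef_eq0.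
have [s0 hs0 smin] := ex_minnP exh; have [j pj jmin] := ex_minnP exp.
have js : smul p h (j + s0) != 0.
  have jlt : (j < (j + s0).+1)%N by rewrite ltnS leq_addr.
  rewrite /smul (bigD1 (Ordinal jlt)) //= addKn big1 ?addr0 ?mulf_neq0 // => i.
  rewrite -val_eqE /= => ij; case: (ltngtP i j) ij => // ij _.
    by case: (eqVneq p`_i 0) => [->|/jmin]; rewrite ?mul0r // leqNgt ij.
  case: (eqVneq (h (j + s0 - i)%N) 0) => [->|/smin]; rewrite ?mulr0 //.
  by have := ltn_ord i; lia.
have Sj : (S <= j + s0)%N.
  by rewrite leqNgt; apply/negP => /ph0 /eqP; rewrite (negPf js).
have jp : (j < size p)%N.
  by rewrite ltnNge; apply/negP => /(nth_default 0) /eqP; rewrite (negPf pj).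
have := smin _ hs1; lia.
Qed.

Definition comb (F : nzRingType) (N : nat) (P : 'rV[{poly F}]_N) (h : 'I_N -> nat -> F) :
  nat -> F := fun s => \sum_i smul (P 0 i) (h i) s.

Record triangular_system (F : nzRingType) (N : nat) (lam : 'I_N -> F) (A : 'M[F]_N)
    (rho : 'I_N -> nat) (h : 'I_N -> nat -> F) : Prop := TriangularSystem {
  sys_inj : injective rho;
  sys_tri : forall i j, A i j != 0 -> (rho j < rho i)%N;
  sys_eq : forall i s, h i s *+ s = lam i * smul 'X (h i) s + \sum_j A i j * h j s }.

Lemma sum_adj_row (F : comNzRingType) N (M : 'M[F]_N) i :
  \sum_k \adj M i k *: row k M = \det M *: delta_mx 0 i.
Proof.
have -> : \sum_k \adj M i k *: row k M = row i (\adj M *m M).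
  by rewrite row_mul mulmx_sum_row; apply: eq_bigr => k _; rewrite [in RHS]mxE.
by rewrite mul_adj_mx; apply/rowP => j; rewrite !mxE eqxx eq_sym mulr_natr.
Qed.

Section ZeroEstimate.
Variable F : numFieldType.

Lemma comb_connection N (lam : 'I_N -> F) A rho h P s :
  triangular_system lam A rho h ->
  comb (connection lam A^T P) h s = comb P h s *+ s.
Proof.
move=> sys; rewrite /comb -sumrMnl.
rewrite [RHS](eq_bigr (fun i => smul (eulerD (P 0 i)) (h i) s +
   lam i * smul ('X * P 0 i) (h i) s + \sum_j A i j * smul (P 0 i) (h j) s)); last first.
  move=> i _; rewrite smul_eulerD -addrA; congr (_ + _).
  rewrite (@eq_smulr _ _ _ (fun k => \sum_(b : bool)
     if b then lam i * smul 'X (h i) k else \sum_j A i j * h j k)); last first.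
    by move=> k _; rewrite (sys_eq sys) big_bool.
  rewrite smul_sumr big_bool /= smulZr -smulM [_ * 'X]mulrC smul_sumr; congr (_ + _).
  by apply: eq_bigr => j _; rewrite smulZr.
rewrite big_split /= [X in _ = _ + X]exchange_big -big_split /=; apply: eq_bigr => i _.
rewrite mxE !smulDl smulZl smul_suml; congr (_ + _ + _).
by apply: eq_bigr => j _; rewrite mxE smulZl.
Qed.

Lemma comb_iter_connection N (lam : 'I_N -> F) A rho h P k s :
  triangular_system lam A rho h ->
  comb (iter k (connection lam A^T) P) h s = s%:R ^+ k * comb P h s.
Proof.
move=> sys; elim: k => [|k IH]; first by rewrite mul1r.
by rewrite iterS (comb_connection _ _ sys) IH exprS -mulrA mulr_natl.
Qed.

Lemma comb_lincomb N (h : 'I_N -> nat -> F) (I : finType) (a : I -> {poly F})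
    (P : I -> 'rV[{poly F}]_N) s :
  comb (\sum_k a k *: P k) h s = \sum_k smul (a k) (comb (P k) h) s.
Proof.
rewrite [RHS](eq_bigr (fun k => \sum_i smul (a k * P k 0 i) (h i) s)); last first.
  by move=> k _; rewrite smul_sumr; apply: eq_bigr => i _; rewrite smulM.
rewrite exchange_big; apply: eq_bigr => i _; rewrite summxE smul_suml.
by apply: eq_bigr => k _; rewrite mxE.
Qed.

(** The bound is uniform over all constant combinations so that it survives the replacement of the
    series by combinations of them in [krylov_reduce]. *)
Definition order_le N (h : 'I_N -> nat -> F) (C : nat) : Prop :=
  forall c : 'rV[F]_N, c != 0 -> exists2 s, (s <= C)%N & \sum_i c 0 i * h i s != 0.

(** Cramer's rule: the adjugate writes the determinant times [h_i] as a combination of the derived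
    forms, each of order at least [S]. *)
Lemma krylov_order N (lam : 'I_N -> F) A rho h P S i :
  triangular_system lam A rho h -> (forall s, (s < S)%N -> comb P h s = 0) ->
  forall s, (s < S)%N -> smul (\det (krylov lam A^T P)) (h i) s = 0.
Proof.
move=> sys PS s sS; set K := krylov _ _ _.
have adjK := sum_adj_row K i.
have -> : smul (\det K) (h i) s = comb (\sum_k \adj K i k *: row k K) h s.
  rewrite adjK /comb (bigD1 i) //= big1 ?addr0 => [|j ji]; rewrite !mxE eqxx ?eqxx ?mulr1 //.
  by rewrite (negPf ji) mulr0 smul0l.
rewrite comb_lincomb big1 // => k _; apply: (@smul_order0 _ _ _ S) => // t tS.
suff -> : row k K = iter k (connection lam A^T) P.
  by rewrite (comb_iter_connection _ _ _ sys) PS ?mulr0 // (leq_trans tS).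
by apply/rowP => j; rewrite !mxE.
Qed.

Lemma size_det_krylov N (lam : 'I_N -> F) A (P : 'rV[{poly F}]_N) n :
  (forall i, (size (P 0%R i) <= n.+1)%N) ->
  (size (\det (krylov lam A P)) <= (N * n + N * N).+1)%N.
Proof.
move=> Pn; apply: leq_trans (size_det_bound (d := fun=> (n + N)%N) _) _.
  move=> i j; rewrite mxE; apply: leq_trans (size_iter_connection _ _ _ Pn _) _.
  by rewrite addSn ltnS leq_add2l ltnW.
by rewrite sum_nat_const card_ord mulnDr.
Qed.

(* If sum_i c_i P_i = 0 with c_i = 1, the index i is eliminated by replacing
   h_j by h_j - c_j h_i. *)
Lemma krylov_reduce N (lam : 'I_N.+1 -> F) A rho h (P : 'rV[{poly F}]_N.+1) n C :
  triangular_system lam A rho h -> \det (krylov lam A^T P) = 0 -> P != 0 ->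
  (forall i, (size (P 0%R i) <= n)%N) -> order_le h C ->
  exists (lam' : 'I_N -> F) A' rho' h' P',
    [/\ triangular_system lam' A' rho' h', comb P' h' =1 comb P h, P' != 0,
     forall i, (size (P' 0%R i) <= n)%N & order_le h' C].
Proof.
move=> sys det0 P0 Pn hC.
have [c0 [m [c00 Pc0 lc0 Ac0]]] := det_krylov0 (sys_inj sys) (sys_tri sys) det0.
(* The index of lowest rank in the support is eliminated so that the new matrix stays triangular:
   row [j] changes by [c_j] times row [i], whose nonzero entries lie below [i], hence below every
   [j] with [c_j] nonzero. *)
have [i [ci0 imin]] : exists i, c0 0 i != 0 /\ forall j, c0 0 j != 0 -> (rho i <= rho j)%N.
  have /rV0Pn[k ck] := c00.
  by have [i ci imin] := @arg_minnP _ k (fun j => c0 0 j != 0) rho ck; exists i.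
pose c j := c0 0 j / c0 0 i.
have ci : c i = 1 by rewrite /c divff.
have Pc : \sum_j c j *: P 0 j = 0.
  transitivity ((c0 0 i)^-1 *: \sum_j c0 0 j *: P 0 j); last by rewrite Pc0 scaler0.
  by rewrite scaler_sumr; apply: eq_bigr => j _; rewrite scalerA mulrC.
have lc j : c j * lam i = c j * lam j.
  case: (lc0 j) => [|->]; first by rewrite /c => ->; rewrite !mul0r.
  by case: (lc0 i) => [/eqP|->//]; rewrite (negPf ci0).
have Ac j : \sum_k A j k * c k = 0.
  transitivity ((\sum_k A j k * c0 0 k) / c0 0 i); last by rewrite Ac0 mul0r.
  by rewrite mulr_suml; apply: eq_bigr => k _; rewrite mulrA.
have crho j : c j != 0 -> (rho i <= rho j)%N.
  by move=> cj; apply: imin; apply: contraNneq cj; rewrite /c => ->; rewrite mul0r.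
pose l := lift i.
exists (lam \o l), (\matrix_(j, k) (A (l j) (l k) - c (l j) * A i (l k))), (rho \o l),
  (fun j s => h (l j) s - c (l j) * h i s), (\row_j P 0 (l j)).
split.
- split.
  + by apply: inj_comp (sys_inj sys) (lift_inj).
  + move=> j k; rewrite mxE /=; case: (eqVneq (A (l j) (l k)) 0) => [->|/(sys_tri sys)//].
    rewrite add0r oppr_eq0 mulf_eq0 negb_or => /andP[/crho ij /(sys_tri sys) ki].
    exact: leq_trans ki ij.
  (* By [lc], subtracting [c_j h_i] is compatible with the factor [lam_j]; by [Ac], every [h_k] in
     the sum over [A] may be replaced by h_k - c_k h_i. *)
  + move=> j s; rewrite mulrnBl -mulrnAr !(sys_eq sys) /=.
    have -> : smul 'X (fun t => h (l j) t - c (l j) * h i t) s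
            = smul 'X (h (l j)) s - c (l j) * smul 'X (h i) s.
      by rewrite !smulX; case: s => // ; rewrite mulr0 subrr.
    have -> : \sum_k (\matrix_(j, k) (A (l j) (l k) - c (l j) * A i (l k))) j k
          * (h (l k) s - c (l k) * h i s)
       = \sum_k (A (l j) k - c (l j) * A i k) * (h k s - c k * h i s).
      rewrite [RHS](bigD1_ord i) //= ci mul1r subrr mulr0 add0r.
      by apply: eq_bigr => k _; rewrite mxE.
    have -> : \sum_k (A (l j) k - c (l j) * A i k) * (h k s - c k * h i s) =
       \sum_k A (l j) k * h k s - (\sum_k A (l j) k * c k) * h i s
       - c (l j) * (\sum_k A i k * h k s - (\sum_k A i k * c k) * h i s).
      rewrite !mulr_suml -!sumrB mulr_sumr -sumrB; apply: eq_bigr => k _; ring.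
    rewrite !Ac; have := lc (l j).
    move: (c (l j)) (lam i) (lam (l j)) (smul 'X (h i) s) => a b d e E.
    by rewrite mulrDr mulrA E; ring.
- move=> s; rewrite /comb [RHS](bigD1_ord i) //=.
  rewrite (eq_bigr (fun j => smul (P 0 (l j)) (h (l j)) s
      - smul (c (l j) *: P 0 (l j)) (h i) s)); last first.
    move=> j _; rewrite mxE (@eq_smulr _ _ _ (fun k => \sum_(b : bool)
      if b then h (l j) k else - c (l j) * h i k)); last by move=> k _; rewrite big_bool mulNr.
    by rewrite smul_sumr big_bool smulZr smulZl mulNr.
  rewrite sumrB addrC -smul_suml; congr (_ + _).
  have -> : \sum_j c (l j) *: P 0 (l j) = - P 0 i.
    move: Pc; rewrite (bigD1_ord i) //= ci scale1r => /eqP.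
    by rewrite addrC addr_eq0 => /eqP.
  by rewrite smulNl opprK.
- apply: contra_neq P0 => P'0; have Pl j : P 0 (l j) = 0.
    by move/rowP/(_ j): P'0; rewrite !mxE.
  apply/rowP => j; rewrite mxE; case: (unliftP i j) => [k|] ->; first exact: Pl.
  by move: Pc; rewrite (bigD1_ord i) //= ci scale1r big1 ?addr0 // => k _; rewrite Pl scaler0.
- by move=> j; rewrite mxE.
- move=> d d0.
  pose e : 'rV[F]_N.+1 := \row_k if unlift i k is Some j then d 0 j else
     - \sum_j d 0 j * c (l j).
  have el j : e 0 (lift i j) = d 0 j by rewrite mxE liftK.
  have ei : e 0 i = - \sum_j d 0 j * c (l j) by rewrite mxE unlift_none.
  have [|s sC es] := hC e.
    by have /rV0Pn[j dj] := d0; apply/rV0Pn; exists (lift i j); rewrite el.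
  exists s => //; move: es; rewrite (bigD1_ord i) //= ei mulNr mulr_suml addrC -sumrB.
  by congr (_ != 0); apply: eq_bigr => j _; rewrite el -mulrA -mulrBr.
Qed.

(** Induction on [N]. A nonzero Krylov determinant has degree at most N n + N^2, while its product
    with a series of order at most [C] vanishes to order [S]. A zero determinant allows one series
    to be eliminated without changing [n], [S] or [C]. *)
Theorem zero_estimate N (lam : 'I_N -> F) A rho h (P : 'rV[{poly F}]_N) n S C :
  triangular_system lam A rho h -> order_le h C -> P != 0 ->
  (forall i, (size (P 0%R i) <= n.+1)%N) -> (forall s, (s < S)%N -> comb P h s = 0) ->
  (S <= N * n + N * N + C)%N.
Proof.
elim: N lam A rho h P => [|N IH] lam A rho h P sys hC P0 Pn PS.
  by case/eqP: P0; apply/rowP => -[].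
case: (eqVneq (\det (krylov lam A^T P)) 0) => det0.
  have [lam' [A' [rho' [h' [P' [sys' hh' P'0 P'n hC']]]]]] := krylov_reduce sys det0 P0 Pn hC.
  have PS' s : (s < S)%N -> comb P' h' s = 0 by rewrite hh'; exact: PS.
  by have := IH _ _ _ _ _ sys' hC' P'0 P'n PS'; nia.
have := size_det_krylov lam A^T Pn.
have : (S < size (\det (krylov lam A^T P)) + C)%N.
  apply: (smul_order det0 _ (krylov_order ord0 sys PS)).
  have [|s sC hs] := hC (delta_mx 0 ord0).
    by apply/rV0Pn; exists ord0; rewrite mxE !eqxx oner_neq0.
  exists s => //; apply: contraNneq hs => hs; rewrite (bigD1 ord0) //= hs mulr0 add0r.
  by apply/eqP; apply: big1 => j j0; rewrite mxE eqxx (negPf j0) mul0r.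
by lia.
Qed.

(** A zero determinant would leave a nonzero form in N - 1 series with the same order at 0, more
    than [zero_estimate] permits for N - 1. *)
Corollary det_krylov_neq0 N (lam : 'I_N -> F) A rho h (P : 'rV[{poly F}]_N) n S C :
  triangular_system lam A rho h -> order_le h C -> P != 0 ->
  (forall i, (size (P 0%R i) <= n.+1)%N) -> (forall s, (s < S)%N -> comb P h s = 0) ->
  (N.-1 * n + N * N + C < S)%N -> \det (krylov lam A^T P) != 0.
Proof.
case: N lam A rho h P => [|N] lam A rho h P sys hC P0 Pn PS SC.
  by rewrite det_mx00 oner_neq0.
apply/eqP => det0.
have [lam' [A' [rho' [h' [P' [sys' hh' P'0 P'n hC']]]]]] := krylov_reduce sys det0 P0 Pn hC.
have PS' s : (s < S)%N -> comb P' h' s = 0 by rewrite hh'; exact: PS.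
by have := zero_estimate sys' hC' P'0 P'n PS'; move: SC => /=; nia.
Qed.

End ZeroEstimate.

(** * Linear independence of the series over the constants *)

Section LinearIndependence.
Variable F : numFieldType.

Definition series_free N (h : 'I_N -> nat -> F) : Prop :=
  forall c : 'rV[F]_N, c != 0 -> exists s, \sum_i c 0 i * h i s != 0.

(** The rank of the matrix of the first s coefficients is at most [N], so it is maximal for some
    [s0]. From there on the left kernel no longer shrinks, and [s0] serves as the uniform bound. *)
Lemma series_free_order N (h : 'I_N -> nat -> F) :
  series_free h -> exists C, order_le h C.
Proof.
move=> hfree; pose H s : 'M[F]_(N, s) := \matrix_(i, k) h i k.
have HP s (u : 'rV_N) : u *m H s = 0 <-> forall k, (k < s)%N -> \sum_i u 0 i * h i k = 0.
  split=> [/rowP uH k ks|uH].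
    by have := uH (Ordinal ks); rewrite !mxE => E; rewrite -[RHS]E; apply: eq_bigr => i _; rewrite mxE.
  apply/rowP => k; rewrite !mxE -[RHS](uH k (ltn_ord k)).
  by apply: eq_bigr => i _; rewrite mxE.
pose P r := `[< exists s, \rank (H s) = r >].
have exP : exists r, P r by exists (\rank (H 0%N)); apply/asboolP; exists 0%N.
have [r /asboolP[s0 rs0] rmax] := ex_maxnP exP (m := N)
  (fun r => fun Pr : P r => let: ex_intro s e := asboolW Pr in
     eq_ind _ (fun r => r <= N)%N (rank_leq_row (H s)) _ e).
exists s0 => c c0; have [s cs] := hfree c c0.
case: (leqP s s0) => ss0; first by exists s.
have /eqP Hc : c *m H s0 != 0.
  apply: contraNneq cs => cH; have : (c <= kermx (H s.+1))%MS.
    have le : (kermx (H s.+1) <= kermx (H s0))%MS.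
      apply/rV_subP => u /sub_kermxP /HP uH; apply/sub_kermxP/HP => k ks.
      by apply: uH; rewrite ltnS ltnW // (ltn_trans ks).
    have /leqifP := mxrank_leqif_sup le; case: ifP => [ge _|_].
      by apply: submx_trans ge; apply/sub_kermxP.
    rewrite !mxrank_ker rs0.
    have : (\rank (H s.+1) <= r)%N by apply: rmax; apply/asboolP; exists s.+1.
    lia.
  by move=> /sub_kermxP /HP ->.
have : exists k, (k < s0)%N && (\sum_i c 0 i * h i k != 0).
  apply/not_existsP => all0; apply: Hc; apply/HP => k ks.
  by apply/eqP; apply: contraT => hk; case: (all0 k); rewrite ks.
by case=> k /andP[ks hk]; exists k => //; exact: ltnW.
Qed.

(** The polynomial relations between the [h_i] form a stable module. If it were nonzero it would
    contain a multiple of a constant eigenvector, hence a constant relation of exactly the shape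
    that the hypothesis excludes. *)
Lemma triangular_series_free N (lam : 'I_N -> F) A rho h :
  triangular_system lam A rho h ->
  (forall (c : 'rV[F]_N) m, c != 0 -> (forall i, c 0 i = 0 \/ lam i = m) ->
    (forall j, \sum_i c 0 i * A i j = 0) -> exists s, \sum_i c 0 i * h i s != 0) ->
  series_free h.
Proof.
move=> sys noeig c c0; apply/not_existsP => ch0.
have ch s : \sum_i c 0 i * h i s = 0.
  by apply/eqP; apply: contraT => hs; case: (ch0 s).
pose W P := forall s, comb P h s = 0.
(* Transposing the matrix reverses the triangular order, so the ranks are reflected. *)
pose rho' i := (\sum_j rho j - rho i)%N.
have rle i : (rho i <= \sum_j rho j)%N by rewrite (bigD1 i) //= leq_addr.
have [|i j||||c' [y [m [c'0 y0 Wc cm cA]]]] := @stable_const_eigenvector F N lam A^T rho' _ _ W.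
- by move=> i j E; apply: (sys_inj sys); have := rle i; have := rle j; rewrite /rho' in E; lia.
- rewrite mxE => /(sys_tri sys); have := rle i; have := rle j; rewrite /rho'; lia.
- move=> a b q q' Wq Wq' s.
  have := comb_lincomb h (fun t : bool => if t then a else b) (fun t => if t then q else q') s.
  rewrite !big_bool /= => ->.
  by rewrite !(@smul_order0 _ _ _ s.+1) ?addr0.
- by move=> q Wq s; rewrite (comb_connection _ _ sys) Wq mul0rn.
- exists (map_mx polyC c).
    move=> s; rewrite -[RHS](ch s); apply: eq_bigr => i _.
    by rewrite mxE -[_%:P]mulr1 mul_polyC smulZl smul1.
  have /rV0Pn[i ci] := c0; apply/rV0Pn; exists i; by rewrite mxE polyC_eq0.
- have [|s cs] := noeig c' m c'0 cm.
    by move=> j; rewrite -[RHS](cA j); apply: eq_bigr => i _; rewrite mxE mulrC.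
  suff : (size y + s < size y + s)%N by rewrite ltnn.
  apply: (@smul_order _ y (fun s => \sum_i c' 0 i * h i s) _ s y0); first by exists s.
  move=> t _; rewrite smul_sumr -[RHS](Wc t); apply: eq_bigr => i _.
  by rewrite !mxE smulZr [y * _]mulrC mul_polyC smulZl.
Qed.

End LinearIndependence.

(** * Siegel's lemma and denominators *)

(** Pigeonhole with M = #|I| unknowns in [0, B], B = Q^e and Q = 2 M H. The (B + 1)^M vectors are
    sent into a box of (2 K + 1)^S points, where 2 K + 1 = Q B + 1 is at most Q (B + 1). The
    condition on [e] gives Q^S <= B^(M - S), so two vectors collide, and their difference is the
    solution. *)
Lemma siegel_lemma (I : finType) (S H e : nat) (A : 'I_S -> I -> int) :
  (0 < H)%N -> (S < #|I|)%N -> (S <= e * (#|I| - S))%N -> (forall s i, `|A s i| <= H%:Z) ->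
  exists x : I -> int, [/\ exists i, x i != 0,
    forall i, `|x i| <= ((2 * #|I| * H) ^ e)%N%:Z & forall s, \sum_i A s i * x i = 0].
Proof.
move=> H0 SM Se AH; set Q := (2 * #|I| * H)%N; set B := (Q ^ e)%N; pose K := (#|I| * H * B)%N.
have bnd (x : {ffun I -> 'I_B.+1}) s : `|\sum_i A s i * (x i)%:Z| <= K%:Z.
  apply: le_trans (ler_norm_sum _ _ _) _.
  apply: (@le_trans _ _ (\sum_(i : I) (H * B)%N%:Z)).
    apply: ler_sum => i _; rewrite normrM PoszM ler_pM //.
    by rewrite ger0_norm // lez_nat -ltnS.
  rewrite sumr_const -mulr_natl natz -PoszM mulnA; exact: lexx.
pose phi (x : {ffun I -> 'I_B.+1}) : {ffun 'I_S -> 'I_(2 * K).+1} :=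
  [ffun s => inord (absz (\sum_i A s i * (x i)%:Z + K%:Z))].
have /injectivePn[x [y xy Exy]] : ~~ injectiveb phi.
  apply/negP => /injectiveP /leq_card; rewrite !card_ffun !card_ord leqNgt.
  move/negP; apply; have Q0 : (0 < Q)%N by rewrite /Q !muln_gt0 H0 (leq_ltn_trans _ SM).
  apply: (@leq_ltn_trans ((Q * B.+1) ^ S)%N).
    have [->|S0] := posnP S; first by rewrite !expn0.
    by rewrite leq_exp2r // /K /Q; move: (B) => b; nia.
  rewrite expnMn -[X in (_ < _ ^ X)%N](subnK (ltnW SM)) expnD ltn_pmul2r ?expn_gt0 //.
  apply: (@leq_ltn_trans (B ^ (#|I| - S))%N); first by rewrite /B -expnM leq_pexp2l.
  by rewrite ltn_exp2r ?subn_gt0.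
have Es s : \sum_i A s i * (x i)%:Z = \sum_i A s i * (y i)%:Z.
  move/ffunP/(_ s): Exy; rewrite !ffunE => /(congr1 val) /=.
  move: (bnd x s) (bnd y s); set a := \sum_i _ * (x i)%:Z; set b := \sum_i _.
  move=> aK bK; rewrite !inordK; lia.
exists (fun i => (x i)%:Z - (y i)%:Z); split.
- have /existsP[i xi] : [exists i, x i != y i].
    apply: contraNT xy; rewrite negb_exists => /forallP xy; apply/eqP/ffunP => i.
    by apply/eqP; rewrite -[_ == _]negbK xy.
  by exists i; rewrite subr_eq0.
- move=> i; have := ltn_ord (x i); have := ltn_ord (y i); lia.
- move=> s; apply/eqP; under eq_bigr => i _ do rewrite mulrBr.
  by rewrite sumrB Es subrr.
Qed.

(** * An exponential bound for lcm(1, ..., n) *)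

Definition lcm_upto n := \big[lcmn/1%N]_(1 <= k < n.+1) k.

Lemma dvdn_lcm_upto k n : (0 < k)%N -> (k <= n)%N -> (k %| lcm_upto n)%N.
Proof.
move=> k0 kn; rewrite /lcm_upto (big_cat_nat (n := k)) //=; last by rewrite ltnW.
by rewrite [X in lcmn _ X]big_ltn //; apply: dvdn_trans (dvdn_lcmr _ _); exact: dvdn_lcml.
Qed.

Lemma lcm_upto_gt0 n : (0 < lcm_upto n)%N.
Proof.
rewrite /lcm_upto big_seq; elim/big_ind: _ => // [a b|k]; first by rewrite lcmn_gt0 => -> ->.
by rewrite mem_index_iota => /andP[].
Qed.

Lemma lcm_upto_dvdn n d : (forall k, (0 < k)%N -> (k <= n)%N -> (k %| d)%N) -> (lcm_upto n %| d)%N.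
Proof.
move=> kd; rewrite /lcm_upto big_seq; elim/big_ind: _ => // [a b|k].
  by rewrite dvdn_lcm => -> ->.
by rewrite mem_index_iota => /andP[k0 kn]; apply: kd.
Qed.

(* If p ^ a divides k with n < p ^ a <= 2n, then p contributes a carry to the
   central binomial coefficient. *)
Lemma lcm_upto_double n : (lcm_upto n.*2 %| lcm_upto n * 'C(n.*2, n))%N.
Proof.
apply: lcm_upto_dvdn => k k0 kn.
have C0 : (0 < 'C(n.*2, n))%N by rewrite bin_gt0 -addnn leq_addr.
have LC0 : (0 < lcm_upto n * 'C(n.*2, n))%N by rewrite muln_gt0 lcm_upto_gt0.
apply/(dvdn_partP _ k0) => p; rewrite mem_primes => /and3P[pp _ pk].
rewrite p_part; set a := logn p k.
have a0 : (0 < a)%N by rewrite logn_gt0 mem_primes pp k0.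
have pak : (p ^ a <= k)%N by rewrite dvdn_leq // pfactor_dvdn.
case: (leqP (p ^ a) n) => pan.
  by apply: dvdn_mulr; apply: dvdn_lcm_upto; rewrite // expn_gt0 prime_gt0.
have pan' : (p ^ a <= n.*2)%N := leq_trans pak kn.
rewrite -(prednK a0) expnSr; apply: dvdn_mul.
  apply: dvdn_lcm_upto; first by rewrite expn_gt0 prime_gt0.
  move: pan'; rewrite -{1}(prednK a0) expnS -mul2n => pan'.
  have := prime_gt1 pp; nia.
have E : ('C(n.*2, n) * (n`! * n`!) = (n.*2)`!)%N.
  by rewrite -[in RHS](@bin_fact n.*2 n) -addnn ?leq_addr // addnK.
have := congr1 (logn p) E; rewrite !lognM ?muln_gt0 ?fact_gt0 //.
rewrite !logn_fact // => EL; rewrite -(expn1 p) pfactor_dvdn //.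
have n2 : (n <= n.*2)%N by rewrite -addnn leq_addr.
have ext : (\sum_(1 <= k < n.+1) n %/ p ^ k = \sum_(1 <= k < n.*2.+1) n %/ p ^ k)%N.
  rewrite [RHS](big_cat_nat (n := n.+1)) //=.
  have -> : (\sum_(n.+1 <= k < n.*2.+1) n %/ p ^ k = 0)%N; last by rewrite addn0.
  rewrite big_nat_cond; apply: big1 => i /andP[/andP[ni _] _].
  apply: divn_small; apply: leq_trans ni _; exact/ltnW/ltn_expl/prime_gt1.
rewrite ext in EL.
have aR : (a < n.*2.+1)%N by rewrite ltnS (leq_trans _ pan') // ltnW // ltn_expl ?prime_gt1.
have split f : (\sum_(1 <= k < n.*2.+1) f k = \sum_(1 <= k < a) f k +
    (f a + \sum_(a.+1 <= k < n.*2.+1) f k))%N.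
  by rewrite (big_cat_nat (n := a)) ?(ltnW aR) // (big_ltn aR).
rewrite (split (fun k => n %/ p ^ k)%N) (split (fun k => n.*2 %/ p ^ k)%N) in EL.
(* Legendre's formula is compared term by term: floor(2n / p^k) is at least twice floor(n / p^k),
   and for k = a it is at least 1 while floor(n / p^a) = 0. This is the missing factor [p]. *)
have ge i j : (\sum_(i <= k < j) n %/ p ^ k + \sum_(i <= k < j) n %/ p ^ k
    <= \sum_(i <= k < j) n.*2 %/ p ^ k)%N.
  rewrite -big_split /=; apply: leq_sum => l _; rewrite -addnn.
  rewrite leq_divRL ?expn_gt0 ?prime_gt0 // mulnDl; apply: leq_add; exact: leq_trunc_div.
have := ge 1%N a; have := ge a.+1 n.*2.+1.
have : (n %/ p ^ a = 0)%N by rewrite divn_small.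
have : (1 <= n.*2 %/ p ^ a)%N by rewrite divn_gt0 // expn_gt0 prime_gt0.
lia.
Qed.

Lemma bin_le_exp2 n k : ('C(n, k) <= 2 ^ n)%N.
Proof.
elim: n k => [|n IH] [|k] //; first by rewrite bin0 expn_gt0.
by rewrite binS expnS mul2n -addnn leq_add.
Qed.

Lemma lcm_upto_mono m n : (m <= n)%N -> (lcm_upto m <= lcm_upto n)%N.
Proof.
move=> mn; apply: dvdn_leq; first exact: lcm_upto_gt0.
by apply: lcm_upto_dvdn => k k0 km; apply: dvdn_lcm_upto => //; exact: leq_trans mn.
Qed.

Lemma lcm_upto_exp2 j : (lcm_upto (2 ^ j) <= 4 ^ (2 ^ j))%N.
Proof.
elim: j => [|j IH]; first by rewrite /lcm_upto expn0 big_nat1.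
rewrite expnS mul2n.
apply: (@leq_trans (lcm_upto (2 ^ j) * 'C((2 ^ j).*2, 2 ^ j))%N).
  by rewrite dvdn_leq ?lcm_upto_double // muln_gt0 lcm_upto_gt0 bin_gt0 -addnn leq_addr.
apply: leq_trans (leq_mul IH (bin_le_exp2 _ _)) _.
by rewrite -mul2n (expnM 2 2) -expnD addnn mul2n.
Qed.

(** A power of 2 above n and at most 2 n exists when n > 0, whence 16 = 4^2. Exponential growth here
    keeps the entries of the system in Siegel's lemma exponential in [S]. *)
Lemma lcm_upto_bound n : (lcm_upto n <= 16 ^ n)%N.
Proof.
case: n => [|n]; first by rewrite /lcm_upto big_geq.
have [/andP[lo hi]] := trunc_log_bounds (isT : 1 < 2)%N (isT : 0 < n.+1)%N.
apply: leq_trans (lcm_upto_mono (ltnW hi)) _; apply: leq_trans (lcm_upto_exp2 _) _.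
by rewrite (_ : 16 = 4 ^ 2)%N // -expnM expnS leq_pexp2l // leq_mul2l lo.
Qed.

Lemma leq_expn2r m n e : (m <= n)%N -> (m ^ e <= n ^ e)%N.
Proof. by case: e => // e mn; rewrite leq_exp2r. Qed.

Lemma natr_fact_neq0 (R : numDomainType) n : (n`!%:R : R) != 0.
Proof. by rewrite pnatr_eq0 -lt0n fact_gt0. Qed.

Lemma natr_bin (R : numFieldType) s j : (j <= s)%N ->
  ('C(s, j)%:R : R) = s`!%:R / (j`!%:R * (s - j)`!%:R).
Proof.
by move=> js; rewrite -(bin_fact js) !natrM mulfK // mulf_neq0 ?natr_fact_neq0.
Qed.

Lemma smul_widen (F : nzRingType) m (p : {poly F}) (h : nat -> F) s : (size p <= m)%N ->
  smul p h s = \sum_(j < m) (if (j <= s)%N then p`_j * h (s - j)%N else 0).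
Proof.
move=> pm; pose g j := if (j <= s)%N then p`_j * h (s - j)%N else 0.
have ext k : (k <= s.+1 + m)%N -> (forall j, (k <= j)%N -> g j = 0) ->
    \sum_(0 <= j < k) g j = \sum_(0 <= j < s.+1 + m) g j.
  move=> kK gk; rewrite [RHS](big_cat_nat (n := k)) //=.
  rewrite (_ : \sum_(k <= j < s.+1 + m) g j = 0) ?addr0 // big_nat_cond big1 // => j.
  by case/andP=> /andP[/gk].
rewrite -(big_mkord xpredT g) /smul.
transitivity (\sum_(0 <= j < s.+1) g j).
  by rewrite big_mkord; apply: eq_bigr => j _; rewrite /g -ltnS ltn_ord.
rewrite ext ?leq_addr // => [|j]; last by rewrite /g ltnNge => /negPf ->.
by rewrite [RHS]ext ?leq_addl // => j mj; rewrite /g nth_default ?mul0r ?if_same // (leq_trans pm).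
Qed.

(** * The auxiliary form of high order at 0 *)

Section AuxiliaryForm.
Variables (R : realType) (N : nat) (f : 'I_N -> nat -> R) (c E : nat).
Hypothesis c0 : (0 < c)%N.
Hypothesis fbound : forall i s, `|f i s| <= c%:R ^+ s / s`!%:R.
Hypothesis fint : forall i s T, (s <= T)%N ->
  (lcm_upto T ^ E * s`!)%:R * f i s \is a Num.int.

(* Siegel's lemma, applied to the coefficients of n! z^j / j! in each component. *)
Lemma auxiliary_form n S e B : (S < N * n.+1)%N -> (S <= e * (N * n.+1 - S))%N ->
  B = ((2 * (N * n.+1) * (2 * c * 16 ^ E) ^ S) ^ e)%N ->
  exists P : 'rV[{poly R}]_N, [/\ P != 0, forall i, (size (P 0%R i) <= n.+1)%N,
    forall i j, (P 0 i)`_j \is a Num.int /\ `|(P 0 i)`_j| <= (n`! * B)%:R,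
    forall s, (s < S)%N -> comb P f s = 0 &
    forall s, `|comb P f s| <= (N * (n`! * B))%:R * c.+1%:R ^+ s / s`!%:R].
Proof.
move=> SM Se; set H := ((2 * c * 16 ^ E) ^ S)%N => BE.
have H0 : (0 < H)%N by rewrite expn_gt0 !muln_gt0 c0 expn_gt0.
(* Contribution of the unknown [ij] to the coefficient of z^s, scaled by s! lcm^E / n!. The quotient
   s! / j! becomes a binomial times (s - j)!, which clears the denominator of [f], and the entry is
   at most (2 c 16^E)^S. *)
pose z (s : 'I_S) (ij : 'I_N * 'I_n.+1) : R := if (ij.2 <= s)%N then
   (lcm_upto S ^ E * 'C(s, ij.2) * (s - ij.2)`!)%:R * f ij.1 (s - ij.2)%N else 0.
have zint s ij : z s ij \is a Num.int.
  rewrite /z; case: ifP => _ //; rewrite mulnAC natrM mulrAC rpredM ?natr_int //.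
  by apply: fint; rewrite (leq_trans (leq_subr _ _)) // ltnW.
pose A s ij := Num.floor (z s ij).
have Az s ij : (A s ij)%:~R = z s ij by apply/eqP; rewrite -intrEfloor; exact: zint.
have AH s ij : `|A s ij| <= H%:Z.
  rewrite -(ler_int R) intr_norm Az /z; case: ifP => js; last by rewrite normr0 ler0n.
  rewrite normrM normr_nat; apply: le_trans (ler_wpM2l (ler0n _ _) (fbound _ _)) _.
  rewrite natrM -mulrA [_%:R * (_ / _)]mulrC divfK ?natr_fact_neq0 // -natrX -natrM ler_nat.
  apply: (@leq_trans (((16 ^ S) ^ E * 2 ^ S) * c ^ S)%N).
    apply: leq_mul; first apply: leq_mul.
    - by apply: leq_expn2r; rewrite (leq_trans (lcm_upto_bound _)).
    - by apply: leq_trans (bin_le_exp2 _ _) _; rewrite leq_pexp2l // ltnW.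
    - by rewrite leq_pexp2l // (leq_trans (leq_subr _ _)) // ltnW.
  by rewrite /H !expnMn -!expnM [(E * S)%N]mulnC -mulnA mulnC.
have M0 : (0 < N * n.+1)%N by rewrite (leq_ltn_trans _ SM).
have cardM : #|{: 'I_N * 'I_n.+1}| = (N * n.+1)%N by rewrite card_prod !card_ord.
have [||x [[[i0 j0] x0] xB xA]] := siegel_lemma H0 _ _ AH (e := e); rewrite ?cardM //.
rewrite cardM -BE in xB.
pose P : 'rV[{poly R}]_N := \row_i \poly_(j < n.+1) (n`!%:R / j`!%:R * (x (i, inord j))%:~R).
have Pn i : (size (P 0%R i) <= n.+1)%N by rewrite mxE size_poly.
have Pc i j : (P 0 i)`_j = if (j < n.+1)%N then n`!%:R / j`!%:R * (x (i, inord j))%:~R else 0.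
  by rewrite mxE coef_poly.
have Pb i j : `|(P 0 i)`_j| <= (n`! * B)%:R / j`!%:R.
  rewrite Pc; case: ifP => _; last by rewrite normr0 divr_ge0 ?ler0n.
  rewrite normrM ger0_norm ?divr_ge0 ?ler0n // natrM [X in _ <= X]mulrAC.
  rewrite ler_wpM2l ?divr_ge0 ?ler0n // -intr_norm -[X in _ <= X]/((Posz B)%:~R).
  by rewrite ler_int; exact: xB.
exists P; split => //.
- have /eqP : x (i0, j0) != 0 by [].
  apply: contra_not_neq => P0; have := congr1 (fun Q : 'rV[{poly R}]_N => (Q 0 i0)`_j0) P0.
  rewrite Pc ltn_ord mxE coef0 => /eqP; rewrite !mulf_eq0 invr_eq0 !(negPf (natr_fact_neq0 _ _)) /=.
  by rewrite intr_eq0 inord_val => /eqP.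
- move=> i j; split; last first.
    apply: le_trans (Pb i j) _; rewrite ler_pdivrMr ?ltr0n ?fact_gt0 //.
    by rewrite ler_peMr ?ler0n // ler1n fact_gt0.
  rewrite Pc; case: ifP => // jn; apply: rpredM; last exact: intr_int.
  have /dvdnP[k ->] : (j`! %| n`!)%N.
    by rewrite -(@bin_fact n j) // dvdn_mull // dvdn_mulr.
  by rewrite natrM mulfK ?natr_fact_neq0 // natr_int.
- move=> s sS; rewrite /comb.
  apply: (@mulfI _ (s`!%:R * (lcm_upto S ^ E)%:R / n`!%:R)).
    by rewrite !mulf_neq0 ?invr_eq0 ?natr_fact_neq0 // pnatr_eq0 -lt0n expn_gt0 lcm_upto_gt0.
  have := congr1 (fun y : int => y%:~R : R) (xA (Ordinal sS)); rewrite mulr0 rmorph_sum rmorph0 => xAs; rewrite -[RHS]xAs /=.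
  rewrite mulr_sumr (eq_bigr (fun ij => (A (Ordinal sS) (ij.1, ij.2) * x (ij.1, ij.2))%:~R)); last by case.
  rewrite -(pair_bigA _ (fun i j => (A (Ordinal sS) (i, j) * x (i, j))%:~R)) /=.
  apply: eq_bigr => i _; rewrite (smul_widen _ _ (Pn i)) mulr_sumr; apply: eq_bigr => j _.
  rewrite rmorphM /= Az /z /=; case: ifP => js; last by rewrite mulr0 mul0r.
  rewrite Pc ltn_ord inord_val !natrM natr_bin //.
  by field; rewrite !natr_fact_neq0.
(* The sharper bound with 1 / j! is used for the coefficients of [P]; the binomial sum of c^(s-j)
   then gives (c + 1)^s / s!. *)
- move=> s; rewrite /comb; apply: le_trans (ler_norm_sum _ _ _) _.
  have -> : (N * (n`! * B))%:R * c.+1%:R ^+ s / s`!%:R =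
      \sum_(i < N) (n`! * B)%:R * c.+1%:R ^+ s / s`!%:R :> R.
    by rewrite sumr_const card_ord -[RHS]mulr_natl natrM !mulrA.
  apply: ler_sum => i _; rewrite /smul; apply: le_trans (ler_norm_sum _ _ _) _.
  rewrite -[c.+1]addn1 natrD exprDn mulr_sumr mulr_suml; apply: ler_sum => j _.
  rewrite expr1n mulr1 -[_ *+ 'C(s, j)]mulr_natr normrM.
  have js : (j <= s)%N by rewrite -ltnS.
  apply: le_trans (ler_pM _ _ (Pb i j) (fbound i _)) _ => //.
  rewrite natr_bin // le_eqVlt; apply/orP; left; apply/eqP.
  by field; rewrite !natr_fact_neq0.
Qed.

End AuxiliaryForm.

(** * Independence of the forms at z = 1 *)

Section ConnectionBounds.
Variables (R : realType) (N : nat) (mu : 'I_N -> R) (B : 'M[R]_N) (L : nat).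
Hypothesis mu_int : forall i, mu i \is a Num.int.
Hypothesis B_int : forall i j, B i j \is a Num.int.
Hypothesis L_bound : forall i, `|mu i| + \sum_j `|B i j| <= L%:R.

(** On a polynomial of size at most [m] the derivation multiplies coefficients by less than [m]; the
    terms in [mu] and [B] together contribute at most [L]. *)
Lemma connection_bound m W (q : 'rV[{poly R}]_N) :
  (forall i, (size (q 0%R i) <= m)%N) ->
  (forall i j, (q 0 i)`_j \is a Num.int /\ `|(q 0 i)`_j| <= W) ->
  forall i j, (connection mu B q 0 i)`_j \is a Num.int /\
    `|(connection mu B q 0 i)`_j| <= (m + L)%:R * W.
Proof.
move=> qm qW i j; have W0 : 0 <= W by apply: le_trans (qW i 0%N).2.
have E : (connection mu B q 0 i)`_j = (q 0 i)`_j *+ j + mu i * ('X * q 0 i)`_j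
    + \sum_k B i k * (q 0 k)`_j.
  rewrite mxE !coefD coef_eulerD coefZ coef_sum; congr (_ + _).
  by apply: eq_bigr => k _; rewrite coefZ.
rewrite {}E coefXM; set x := if _ then _ else _.
have [x_int xW] : x \is a Num.int /\ `|x| <= W.
  by rewrite /x; case: ifP => _; [rewrite normr0|exact: qW].
split.
  apply: rpredD; last by apply: rpred_sum => k _; rewrite rpredM // (qW _ _).1.
  by apply: rpredD; [rewrite rpredMn ?(qW _ _).1 | exact: rpredM].
rewrite -addrA natrD mulrDl; apply: le_trans (ler_normD _ _) _; apply: lerD.
  rewrite normrMn -[_ *+ j]mulr_natl; case: (ltnP j m) => jm.
    by apply: ler_pM; rewrite ?ler0n ?ler_nat ?(qW _ _).2 // ltnW.
  by rewrite nth_default ?(leq_trans (qm i)) // normr0 mulr0 mulr_ge0.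
apply: le_trans (ler_wpM2r W0 (L_bound i)); rewrite mulrDl mulr_suml.
apply: le_trans (ler_normD _ _) _; apply: lerD.
  by rewrite normrM ler_wpM2l.
apply: le_trans (ler_norm_sum _ _ _) _; apply: ler_sum => k _.
by rewrite normrM ler_wpM2l // (qW _ _).2.
Qed.

Lemma iter_connection_bound m W G k (q : 'rV[{poly R}]_N) :
  (forall i, (size (q 0%R i) <= m)%N) -> (m + k + L <= G)%N ->
  (forall i j, (q 0 i)`_j \is a Num.int /\ `|(q 0 i)`_j| <= W) ->
  forall i j, (iter k (connection mu B) q 0 i)`_j \is a Num.int /\
    `|(iter k (connection mu B) q 0 i)`_j| <= G%:R ^+ k * W.
Proof.
move=> qm; elim: k => [|k IH] kG qW; first by move=> i j; rewrite mul1r.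
have kG' : (m + k + L <= G)%N by apply: leq_trans kG; rewrite leq_add2r leq_add2l.
move=> i j; have [] := connection_bound (size_iter_connection mu B k qm) (IH kG' qW) i j.
split=> //; apply: le_trans b _; rewrite exprS -mulrA ler_wpM2r ?ler_nat //.
by apply: mulr_ge0; rewrite ?exprn_ge0 ?ler0n //; apply: le_trans (qW i 0%N).2.
Qed.

Lemma horner1_bound m W (p : {poly R}) : (size p <= m)%N ->
  (forall j, p`_j \is a Num.int /\ `|p`_j| <= W) ->
  p.[1] \is a Num.int /\ `|p.[1]| <= m%:R * W.
Proof.
move=> pm pW; rewrite (horner_coef_wide _ pm); split.
  by apply: rpred_sum => j _; rewrite expr1n mulr1 (pW _).1.
apply: le_trans (ler_norm_sum _ _ _) _; rewrite mulr_natl -[in X in _ <= X](card_ord m) -sumr_const.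
by apply: ler_sum => j _; rewrite expr1n mulr1 (pW _).2.
Qed.

End ConnectionBounds.

Section RankAtOne.
Variables (F : numFieldType) (N : nat) (mu : 'I_N -> F) (B : 'M[F]_N).
Local Notation nabla := (connection mu B).
Implicit Types p q : 'rV[{poly F}]_N.

Lemma iter_connectionD k p q : iter k nabla (p + q) = iter k nabla p + iter k nabla q.
Proof. by elim: k => //= k ->; rewrite connectionD. Qed.

(** At 1 only the term where the k derivations fall on the k factors X - 1 survives, and the factor
    X of each derivation takes the value 1 there. *)
Lemma iter_connection_root k (b : {poly F}) p i :
  (iter k nabla (('X - 1)^+ k * b *: p) 0 i).[1] = k`!%:R * b.[1] * (p 0 i).[1].
Proof.
elim: k b p => [|k IH] b p; first by rewrite expr0 mul1r mul1r mxE hornerM.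
rewrite iterSr connectionZ.
have -> : eulerD (('X - 1) ^+ k.+1 * b) =
    ('X - 1) ^+ k * (k.+1%:R *: ('X * b) + ('X - 1) * eulerD b).
  rewrite eulerDM /eulerD deriv_exp derivB derivX derivC subr0 mul1r -mulr_natl -!mul_polyC.
  by rewrite polyC_natr exprS; ring.
rewrite exprSr -mulrA iter_connectionD mxE hornerD !IH.
rewrite !(hornerD, hornerN, hornerZ, hornerM, hornerX, hornerC) subrr !mul0r addr0 mulr0 mul0r addr0.
by rewrite factS natrM mul1r; ring.
Qed.

Lemma spanned_connection m (P : 'rV[{poly F}]_N) p :
  (exists a : nat -> {poly F}, p = \sum_(k < m) a k *: iter k nabla P) ->
  exists a : nat -> {poly F}, nabla p = \sum_(k < m.+1) a k *: iter k nabla P.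
Proof.
case=> a ->; rewrite connection_sum.
exists (fun k => (if (k < m)%N then eulerD (a k) else 0) + (if k is k'.+1 then a k' else 0)).
rewrite [RHS](eq_bigr (fun k : 'I_m.+1 => (if (k < m)%N then eulerD (a k) else 0) *: iter k nabla P
   + (if nat_of_ord k is k'.+1 then a k' else 0) *: iter k nabla P)); last by move=> k _; rewrite scalerDl.
rewrite big_split /= big_ord_recr /= ltnn scale0r addr0 big_ord_recl /= scale0r add0r -big_split.
by apply: eq_bigr => k _; rewrite connectionZ ltn_ord.
Qed.

(** By Cramer's rule, the determinant times the i-th unit vector is a combination of the first N
    derived forms. Applying the connection q times stays within N + q forms and removes the zero of
    order q at 1, leaving q! b(1) times the unit vector. *)
Lemma rank_at_one (P : 'rV[{poly F}]_N) (q : nat) (b : {poly F}) (y : 'I_N -> F) :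
  \det (krylov mu B P) = ('X - 1) ^+ q * b -> b.[1] != 0 ->
  (forall k, (k < N + q)%N -> \sum_i (iter k nabla P 0 i).[1] * y i = 0) ->
  forall i, y i = 0.
Proof.
move=> detP b1 Py i.
have [a Ha] : exists a : nat -> {poly F},
    iter q nabla (('X - 1) ^+ q * b *: delta_mx 0 i) = \sum_(k < N + q) a k *: iter k nabla P.
  rewrite -detP; elim: (q) => [|q' IH]; last by rewrite addnS; exact: spanned_connection.
  exists (fun k => if insub k is Some k' then \adj (krylov mu B P) i k' else 0).
  rewrite addn0 /= -sum_adj_row; apply: eq_bigr => k _; rewrite insubT //= => kN.
  by congr (\adj _ i _ *: _); [exact/val_inj | apply/rowP => j; rewrite !mxE].
have := congr1 (fun p : 'rV[{poly F}]_N => \sum_j (p 0 j).[1] * y j) Ha.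
rewrite (eq_bigr (fun j => q`!%:R * b.[1] * (j == i)%:R * y j)); last first.
  by move=> j _; rewrite iter_connection_root mxE eqxx -polyC_natr hornerC.
rewrite (bigD1 i) //= eqxx mulr1 big1 => [|j /negPf ->]; last by rewrite mulr0 mul0r.
rewrite addr0 (eq_bigr (fun j => \sum_(k < N + q) (a k).[1] * ((iter k nabla P 0 j).[1] * y j))).
  rewrite exchange_big big1 => [/eqP|k _]; last by rewrite -mulr_sumr Py ?mulr0.
  by rewrite !mulf_eq0 (negPf b1) pnatr_eq0 (gtn_eqF (fact_gt0 q)) => /eqP.
move=> j _; rewrite summxE horner_sum mulr_suml; apply: eq_bigr => k _.
by rewrite mxE hornerM mulrA.
Qed.

End RankAtOne.

(** A zero at 0 of order close to the degree leaves little room for a zero at 1, which bounds the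
    number of extra derivations needed there. *)
Lemma order_at_one (F : numFieldType) (p : {poly F}) S D : p != 0 ->
  (forall s, (s < S)%N -> p`_s = 0) -> (size p <= D.+1)%N ->
  exists q b, [/\ p = ('X - 1) ^+ q * b, b.[1] != 0 & (q + S <= D)%N].
Proof.
move=> p0 pS pD; have Ep : p = drop_poly S p * 'X^S.
  rewrite -[LHS](poly_take_drop S) (_ : take_poly S p = 0) ?add0r //.
  by apply/polyP => s; rewrite coef_take_poly coef0; case: ifP => // /pS.
set d := drop_poly S p in Ep; have d0 : d != 0.
  by apply: contra_neq p0 => d0; rewrite Ep d0 mul0r.
have [q [b /implyP/(_ d0) b1 Ed]] := multiplicity_XsubC d 1.
exists q, (b * 'X^S); split.
- by rewrite Ep Ed; ring.
- by rewrite hornerM hornerXn expr1n mulr1.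
- have b0 : b != 0 by apply: contraNneq b1 => ->; rewrite root0.
  have : size p = (q + S + size b)%N.
    have bX : b * ('X - 1%:P) ^+ q != 0 by rewrite -Ed.
    rewrite Ep Ed !size_Mmonic ?monicXn ?monic_exp ?monicXsubC // size_polyXn size_exp_XsubC.
    by move: b0; rewrite -size_poly_gt0; move: (size b) => k k0; lia.
  by move=> E; move: pD b0; rewrite E -size_poly_gt0; move: (size b) => k; lia.
Qed.

(** * Determinants with one row replaced by the relation *)

Section Determinants.
Variable R : realFieldType.

Lemma det_norm_bound n (M : 'M[R]_n) (b : 'I_n -> R) :
  (forall i j, `|M i j| <= b i) -> `|\det M| <= n`!%:R * \prod_i b i.
Proof.
move=> Mb; apply: le_trans (ler_norm_sum _ _ _) _.
rewrite -card_Sn mulr_natl -sumr_const; apply: ler_sum => s _.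
rewrite normrM normrX normrN1 expr1n mul1r normr_prod.
by apply: ler_prod => i _; rewrite normr_ge0 Mb.
Qed.

Definition replace_row n (U : 'M[R]_n) (a : 'rV[R]_n) j : 'M[R]_n :=
  \matrix_(i, k) if i == j then a 0 k else U i k.

Lemma det_replace_row n (U : 'M[R]_n) (a : 'rV[R]_n) :
  U \in unitmx -> a != 0 -> exists j, \det (replace_row U a j) != 0.
Proof.
move=> Uu a0.
have /rV0Pn[j aj] : a *m \adj U != 0.
  apply: contraNneq a0 => aU; rewrite -[a]mulmx1 -(mulVmx Uu) mulmxA.
  by rewrite /invmx Uu -scalemxAr aU scaler0 mul0mx.
exists j; rewrite (expand_det_row _ j); move: aj; rewrite mxE; congr (_ != 0).
apply: eq_bigr => k _; rewrite !mxE eqxx; congr (_ * (_ * \det _)).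
by apply/matrixP => i l; rewrite !mxE eq_sym (negPf (neq_lift _ _)).
Qed.

(** Cramer's rule at the entry [v i0 = 1] writes the determinant as a combination of the entries of
    M v, where the j-th is zero by the relation and the others are at most [Y]. Each remaining
    cofactor contains the row [a] once and n - 1 rows of [U]. *)
Lemma det_replace_row_bound n (U : 'M[R]_n.+1) (a : 'rV[R]_n.+1) j v i0 X Y am :
  0 <= Y -> (forall i k, `|U i k| <= X) -> (forall k, `|a 0 k| <= am) -> v i0 = 1 ->
  \sum_k a 0 k * v k = 0 -> (forall i, `|\sum_k U i k * v k| <= Y) ->
  `|\det (replace_row U a j)| <= (n.+1)`!%:R * (am * X ^+ n.-1 * Y).
Proof.
move=> Y0 UX aam v1 av UY; set M := replace_row U a j.
have X0 : 0 <= X := le_trans (normr_ge0 _) (UX i0 i0).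
have am0 : 0 <= am := le_trans (normr_ge0 _) (aam i0).
have -> : \det M = \sum_(i | i != j) \adj M i0 i * \sum_k U i k * v k.
  have := congr1 (fun Q : 'M[R]_n.+1 => (Q *m (\col_k v k)) i0 0) (mul_adj_mx M).
  rewrite /= -mulmxA mul_scalar_mx !mxE v1 mulr1 => <-.
  rewrite (bigD1 j) //= [X in _ * X](_ : _ = 0) ?mulr0 ?add0r.
    apply: eq_bigr => i ij; congr (_ * _); rewrite mxE; apply: eq_bigr => k _.
    by rewrite !mxE (negPf ij).
  by rewrite mxE -[RHS]av; apply: eq_bigr => k _; rewrite !mxE eqxx.
apply: le_trans (ler_norm_sum _ _ _) _.
apply: (@le_trans _ _ (\sum_(i : 'I_n.+1) n`!%:R * (am * X ^+ n.-1 * Y))); last first.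
  by rewrite sumr_const card_ord -[X in X <= _]mulr_natl mulrA -natrM factS.
rewrite [leRHS](bigID (fun i => i != j)) /= -[leLHS]addr0; apply: lerD; last first.
  by apply: sumr_ge0 => i _; rewrite !mulr_ge0 ?exprn_ge0.
apply: ler_sum => i ij; rewrite normrM !mulrA ler_pM // -mulrA.
rewrite mxE /cofactor normrM normrX normrN1 expr1n mul1r.
apply: le_trans (det_norm_bound (b := fun l => if lift i l == j then am else X) _) _.
  by move=> l k; rewrite !mxE; case: ifP.
rewrite ler_wpM2l ?ler0n //.
case: (unliftP i j) ij => [l0 Ej|->]; last by rewrite eqxx.
move=> _; rewrite (bigD1 l0) //= -Ej eqxx ler_wpM2l // (eq_bigr (fun=> X)); last first.
  by move=> l ll0; rewrite Ej (inj_eq lift_inj) (negPf ll0).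
by rewrite prodr_const cardC1 card_ord.
Qed.

End Determinants.

(** * The final estimate *)

Lemma fact_geq_exp a b : (a`! * a ^ b <= (a + b)`!)%N.
Proof.
elim: b => [|b IH]; first by rewrite muln1 addn0.
rewrite addnS factS expnS mulnCA; apply: leq_mul; last exact: IH.
by rewrite leqW // leq_addr.
Qed.

Lemma fact_mul_leq a b : (a`! * b`! <= (a + b)`!)%N.
Proof.
elim: b => [|b IH]; first by rewrite muln1 addn0.
rewrite addnS !factS mulnCA; apply: leq_mul; last exact: IH.
by rewrite ltnS leq_addl.
Qed.

Lemma fact_mono m n : (m <= n)%N -> (m`! <= n`!)%N.
Proof.
by move=> mn; rewrite -(subnKC mn); apply: leq_trans (fact_mul_leq _ _); rewrite leq_pmulr ?fact_gt0.
Qed.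

Lemma fact_exp_leq a k b : (a`! ^ k * b`! <= (k * a + b)`!)%N.
Proof.
elim: k => [|k IH]; first by rewrite mul1n.
rewrite expnS -mulnA mulSn -addnA; apply: leq_trans (fact_mul_leq _ _).
by rewrite leq_mul2l IH orbT.
Qed.

(* The factorial on the right beats n! ^ (N' + 1) times anything of the form
   Z ^ t * t ^ (3 N' t), since n = (3 N' + 5) t and S - K >= (N' + 2) n - 3 t. *)
Lemma parameter_choice N' c E L am C : exists n S e K B G, let N := N'.+2 in
  [/\ (S < N * n.+1)%N /\ (S <= e * (N * n.+1 - S))%N,
      (N.-1 * n + N * N + C < S)%N /\ (N + (N * n + N * N - S) <= K.+1)%N,
      (2 * K <= S)%N /\ (2 * c.+1 <= S - K)%N,
      B = ((2 * (N * n.+1) * (2 * c * 16 ^ E) ^ S) ^ e)%N /\ G = (n.+1 + K + L)%N &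
      (N`! * (am * (G ^ K.+1 * (n`! * B)) ^ N' * (2 * (N * (n`! * B)) * 2 ^ K * c.+1 ^ S))
        < (S - K)`!)%N].
Proof.
(* [t] is the excess of unknowns over equations, and n = T t. In T = 3 N' + 5, the part 3 is lost in
   S - K, 1 gives the base of [fact_geq_exp], 3 N' pays for G^((K+1) N') as K + 1 <= 3 t, and the
   last 1 leaves t^t. The other constants ensure N (n + 1) <= e t, B <= b1^t and G <= g t; [Z]
   collects the exponential factors, and t > Z. *)
pose N := N'.+2; pose T := (3 * N' + 5)%N; pose e := (N * T.+1)%N.
pose h0 := (4 * (2 * c * 16 ^ E).+1)%N; pose b1 := (h0 ^ (e * e))%N.
pose g := (T + 4)%N.
pose Z := (N`! * am * (2 * N) * g ^ (3 * N') * b1 ^ N'.+1 * 4 * c.+1 ^ e)%N.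
have [t Et] : exists t, t = (Z + L + N * N + C + c + 1)%N by eexists.
have [n En] : exists n, n = (T * t)%N by eexists.
have [S ES] : exists S, S = (N * n.+1 - t)%N by eexists.
have [K EK] : exists K, K = (2 * t)%N by eexists.
pose B := ((2 * (N * n.+1) * (2 * c * 16 ^ E) ^ S) ^ e)%N.
pose G := (n.+1 + K + L)%N.
have Zt : (Z < t)%N by rewrite Et; clear; lia.
have tN : (N * N + C + L + c < t)%N by rewrite Et; clear; lia.
have t0 : (0 < t)%N by apply: leq_ltn_trans Zt.
have Nn : (N * n = 2 * n + N' * n)%N by rewrite /N -addn2 mulnDl addnC.
have n5 : (5 * t <= n)%N by rewrite En leq_mul2r leq_addl orbT.
have ME : (N * n.+1 = N * n + N)%N by rewrite mulnSr.
have SE : (S + t = N * n + N)%N.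
  rewrite ES -ME subnK // ME Nn; move: n5; clear; lia.
have S_M : (N * n.+1 - S = t)%N by rewrite ME -SE; clear; lia.
have Me : (N * n.+1 <= e * t)%N.
  rewrite /e -mulnA leq_mul2l En mulSn; apply/orP; right; move: t0; clear; lia.
have Se : (S <= e * t)%N by apply: leq_trans Me; rewrite ME -SE leq_addr.
have N0 : (1 < N)%N by [].
have K3 : (S - K = N.-1 * n + (n + N - 3 * t))%N.
  have : (N.-1 * n + n = N * n)%N by rewrite -mulSnr prednK.
  by move: SE n5; rewrite EK; clear; lia.
exists n, S, e, K, B, G; split => //.
- split; last by rewrite S_M.
  by rewrite ME -SE -[X in (X < _)%N]addn0 ltn_add2l.
- split; last first.
    by move: SE tN; rewrite EK; clear; lia.
  have : (N.-1 * n + n = N * n)%N by rewrite -mulSnr prednK // ltnW.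
  by move: SE tN n5; clear; lia.
- have : (2 * n <= N * n)%N by rewrite Nn leq_addr.
  by move: SE tN n5 t0; rewrite EK; clear; split; lia.
have Bb : (B <= b1 ^ t)%N.
  have -> : (b1 ^ t = ((4 * (2 * c * 16 ^ E).+1) ^ (e * t)) ^ e)%N.
    by rewrite /b1 -/h0 -!expnM mulnAC.
  apply: leq_expn2r; apply: (@leq_trans ((4 * (2 * c * 16 ^ E).+1) ^ (N * n.+1))%N); last first.
    by rewrite leq_pexp2l.
  rewrite [X in (_ <= X)%N]expnMn; apply: leq_mul.
    rewrite (_ : 4 = 2 ^ 2)%N // -expnM; apply: (@leq_trans (2 ^ 1 * 2 ^ (N * n.+1))%N).
      by rewrite leq_mul2l ltnW // ltn_expl.
    by rewrite -expnD leq_pexp2l // mul2n -addnn leq_add2r muln_gt0 ltnW.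
  apply: leq_trans (leq_expn2r _ (leqnSn _)) _; rewrite leq_pexp2l //.
  by rewrite ME -SE leq_addr.
have Gg : (G <= g * t)%N by rewrite /G /g EK mulnDl -En; move: tN; clear; lia.
have facb : (n`! ^ N'.+1 * t ^ ((3 * N' + 1) * t) <= (S - K)`!)%N.
  apply: (@leq_trans (n`! ^ N'.+1 * (t + (3 * N' + 1) * t)`!)%N).
    rewrite leq_mul2l; apply/orP; right; apply: leq_trans (fact_geq_exp _ _).
    by rewrite leq_pmull // fact_gt0.
  apply: leq_trans (fact_exp_leq _ _ _) (fact_mono _).
  rewrite K3 (_ : N.-1 = N'.+1) // leq_add2l En /T; clear; lia.
apply: leq_trans facb.
have stepA : ((G ^ K.+1 * (n`! * B)) ^ N' <= (g * t) ^ (3 * t * N') * n`! ^ N' * (b1 ^ N') ^ t)%N.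
  rewrite !expnMn -mulnA; apply: leq_mul.
    rewrite -!expnM -expnMn; apply: leq_trans (leq_expn2r _ Gg) _.
    rewrite leq_pexp2l ?muln_gt0 ?t0 //; [by rewrite /g addn4|].
    by rewrite leq_mul2r EK; apply/orP; right; move: t0; clear; lia.
  by rewrite leq_mul2l -expnM [(N' * t)%N]mulnC expnM leq_expn2r ?orbT.
have stepB : (2 * (N * (n`! * B)) * 2 ^ K * c.+1 ^ S <= (2 * N) * n`! * b1 ^ t * 4 ^ t * (c.+1 ^ e) ^ t)%N.
  rewrite !mulnA EK expnM -[(2 ^ 2)%N]/4%N -expnM; apply: leq_mul; last by rewrite leq_pexp2l.
  by apply: leq_mul => //; apply: leq_mul.
apply: (@leq_ltn_trans (N`! * (am * ((g * t) ^ (3 * t * N') * n`! ^ N' * (b1 ^ N') ^ t)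
   * ((2 * N) * n`! * b1 ^ t * 4 ^ t * (c.+1 ^ e) ^ t)))%N).
  by rewrite leq_mul2l; apply/orP; right; apply: leq_mul => //; rewrite leq_mul2l stepA orbT.
have -> : (N`! * (am * ((g * t) ^ (3 * t * N') * n`! ^ N' * (b1 ^ N') ^ t)
   * ((2 * N) * n`! * b1 ^ t * 4 ^ t * (c.+1 ^ e) ^ t)) =
   (n`! ^ N'.+1 * t ^ (3 * N' * t)) * ((N`! * am * (2 * N)) *
    (g ^ (3 * N') * b1 ^ N'.+1 * 4 * c.+1 ^ e) ^ t))%N.
  have -> : ((g * t) ^ (3 * t * N') = (g ^ (3 * N')) ^ t * t ^ (3 * N' * t))%N.
    by rewrite expnMn -expnM; congr (_ ^ _ * _ ^ _)%N; rewrite mulnAC.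
  rewrite [(n`! ^ N'.+1)%N]expnS [(b1 ^ N'.+1)%N]expnS !(expnMn _ _ t).
  move: ((g ^ (3 * N')) ^ t)%N (t ^ (3 * N' * t))%N (b1 ^ t)%N ((b1 ^ N') ^ t)%N (4 ^ t)%N
    ((c.+1 ^ e) ^ t)%N (n`! ^ N')%N n`! (N`!) => x1 x2 x3 x4 x5 x6 x7 x8 x9.
  clear; lia.
have -> : (t ^ ((3 * N' + 1) * t) = t ^ (3 * N' * t) * t ^ t)%N by rewrite mulnDl mul1n expnD.
rewrite [X in (_ < X)%N]mulnA ltn_pmul2l ?muln_gt0 ?expn_gt0 ?fact_gt0 ?t0 //.
set z := (N`! * am * (2 * N))%N.
have Ez : (Z = z * (g ^ (3 * N') * b1 ^ N'.+1 * 4 * c.+1 ^ e))%N by rewrite /Z /z !mulnA.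
apply: (@leq_ltn_trans (Z ^ t)%N); last by rewrite ltn_exp2r.
rewrite Ez (expnMn z) leq_mul2r; apply/orP; right.
by rewrite -{1}[z]expn1; case: (z) => // z'; rewrite leq_pexp2l.
Qed.

(** * Values of the series at 1 and bounds for remainders *)

Section SeriesValues.
Variable R : realType.
Implicit Types (h : nat -> R) (p : {poly R}) (v : R).

Lemma smul_cvg h p v : \sum_(s < T) h s @[T --> \oo] --> v ->
  \sum_(s < T) smul p h s @[T --> \oo] --> p.[1] * v.
Proof.
elim/poly_ind: p h => [|p c IH] h hv.
  rewrite horner0 mul0r (_ : (fun T => _) = fun=> 0); first exact: cvg_cst.
  by apply/funext => T; rewrite big1 // => s _; rewrite smul0l.
have hX : \sum_(s < T) smul 'X h s @[T --> \oo] --> v.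
  rewrite -cvg_shiftS /= (_ : (fun T => _) = fun T => \sum_(s < T) h s) //.
  by apply/funext => T; rewrite big_ord_recl smulX add0r; apply: eq_bigr => s _; rewrite smulX.
rewrite hornerMXaddC mulr1 mulrDl.
rewrite (_ : (fun T => _) = fun T => \sum_(s < T) smul p (smul 'X h) s + c * \sum_(s < T) h s).
  by apply: cvgD; [exact: IH | exact: cvgMl_tmp].
apply/funext => T; rewrite mulr_sumr -big_split; apply: eq_bigr => s _.
by rewrite smulDl smulM -[c%:P]mulr1 mul_polyC smulZl smul1.
Qed.

Lemma comb_cvg N (f : 'I_N -> nat -> R) (v : 'I_N -> R) (P : 'rV[{poly R}]_N) :
  (forall i, \sum_(s < T) f i s @[T --> \oo] --> v i) ->
  \sum_(s < T) comb P f s @[T --> \oo] --> \sum_i (P 0 i).[1] * v i.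
Proof.
move=> fv; rewrite (_ : (fun T => _) = fun T => \sum_i \sum_(s < T) smul (P 0 i) (f i) s); last first.
  by apply/funext => T; rewrite exchange_big.
by apply: cvg_big => [|i _]; [exact: add_continuous | exact: smul_cvg].
Qed.

Lemma cvg_norm_le (u : nat -> R) (l Y : R) : u T @[T --> \oo] --> l ->
  (forall T, `|u T| <= Y) -> `|l| <= Y.
Proof.
move=> ul uY; have ul' : `|u T| @[T --> \oo] --> `|l| by exact: cvg_norm.
rewrite -(cvg_lim (@Rhausdorff R) ul'); apply: limr_le; first by apply/cvg_ex; exists `|l|.
by near=> T; exact: uY.
Unshelve. all: by end_near.
Qed.

(** From [U] on, the ratio of consecutive terms is at most 1/2. The induction carries twice the next
    term along on the left side. *)
Lemma exp_tail_bound (x U : nat) T : (2 * x <= U)%N ->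
  \sum_(U <= u < T) x%:R ^+ u / u`!%:R <= 2 * (x%:R ^+ U / U`!%:R) :> R.
Proof.
move=> xU; have t0 s : 0 <= x%:R ^+ s / s`!%:R :> R by rewrite divr_ge0 ?exprn_ge0 ?ler0n.
case: (leqP U T) => UT; last by rewrite big_geq ?(ltnW UT) //; exact: mulr_ge0.
suff : \sum_(U <= u < T) x%:R ^+ u / u`!%:R + 2 * (x%:R ^+ T / T`!%:R)
    <= 2 * (x%:R ^+ U / U`!%:R) :> R.
  by apply: le_trans; rewrite lerDl; exact: mulr_ge0.
elim: T UT => [|T IH]; first by rewrite leqn0 => /eqP ->; rewrite big_geq ?add0r.
rewrite leq_eqVlt => /orP[/eqP ->|]; first by rewrite big_geq ?add0r.
rewrite ltnS => UT; apply: le_trans (IH UT); rewrite big_nat_recr //= -addrA lerD2l.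
have -> : x%:R ^+ T.+1 / (T.+1)`!%:R = (x%:R / T.+1%:R) * (x%:R ^+ T / T`!%:R) :> R.
  by rewrite exprS factS natrM invfM; ring.
set y := _ ^+ T / _; have y0 : 0 <= y := t0 T.
have : x%:R / T.+1%:R <= 2^-1 :> R.
  rewrite ler_pdivrMr ?ltr0n // mulrC ler_pdivlMr ?ltr0n // -natrM ler_nat mulnC.
  exact: leq_trans xU (leqW UT).
move: (_ / _) => a ha; have : 0 <= y * (2^-1 - a) by rewrite mulr_ge0 ?subr_ge0.
lra.
Qed.

Lemma weighted_tail_bound (r : nat -> R) (x S K k : nat) (W : R) : 0 <= W ->
  (forall s, (s < S)%N -> r s = 0) -> (forall s, `|r s| <= W * x%:R ^+ s / s`!%:R) ->
  (2 * K <= S)%N -> (2 * x <= S - K)%N -> (k <= K)%N -> forall T,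
  `|\sum_(s < T) s%:R ^+ k * r s| <= 2 * W * 2 ^+ K * x%:R ^+ S / (S - K)`!%:R.
Proof.
move=> W0 r0 rW KS xSK kK T; have KS' : (K <= S)%N by lia.
(* As s >= 2 K, each factor s is at most 2 (s - j) for j < K, so K factors s are absorbed by the
   factorial at the cost of 2^K. *)
have powfact s : (S <= s)%N -> s%:R ^+ k / s`!%:R <= 2 ^+ K / (s - K)`!%:R :> R.
  move=> Ss; rewrite ler_pdivrMr ?ltr0n ?fact_gt0 // mulrAC ler_pdivlMr ?ltr0n ?fact_gt0 //.
  rewrite -!natrX -!natrM ler_nat; apply: (@leq_trans (s ^ K * (s - K)`!)%N).
    rewrite leq_mul2r; apply/orP; right; case: (posnP s) => [s0|s0]; last by rewrite leq_pexp2l.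
    have -> : K = 0%N by lia.
    by have -> : k = 0%N by lia.
  have Ks : (2 * K <= s)%N by lia.
  elim: {kK KS xSK KS' Ss} K Ks => [|j IH] js; first by rewrite subn0.
  have -> : (s ^ j.+1 * (s - j.+1)`! = s ^ j * (s * (s - j.+1)`!))%N by rewrite expnS; lia.
  apply: (@leq_trans (s ^ j * (2 * ((s - j) * (s - j.+1)`!)))%N).
    rewrite leq_mul2l; apply/orP; right; rewrite mulnA leq_mul2r; apply/orP; right; lia.
  have -> : ((s - j) * (s - j.+1)`! = (s - j)`!)%N.
    by rewrite (_ : s - j = (s - j.+1).+1)%N ?factS //; lia.
  by rewrite mulnCA expnS -mulnA leq_mul2l; apply: IH; lia.
rewrite -(big_mkord xpredT (fun s => s%:R ^+ k * r s)).
case: (leqP S T) => ST; last first.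
  rewrite big_nat big1 ?normr0 => [|s /andP[_ sT]]; last by rewrite r0 ?mulr0 // (ltn_trans sT).
  by rewrite divr_ge0 ?ler0n // mulr_ge0 ?exprn_ge0 // mulr_ge0 ?exprn_ge0 // mulr_ge0.
rewrite (big_cat_nat (n := S)) //= big_nat big1 ?add0r => [|s /andP[_ sS]]; last first.
  by rewrite r0 ?mulr0.
apply: le_trans (ler_norm_sum _ _ _) _.
apply: (@le_trans _ _ (\sum_(S <= s < T) W * 2 ^+ K * x%:R ^+ K * (x%:R ^+ (s - K) / (s - K)`!%:R))).
  rewrite big_nat [leRHS]big_nat; apply: ler_sum => s /andP[Ss _].
  rewrite normrM normrX normr_nat; apply: le_trans (ler_wpM2l _ (rW s)) _; first by rewrite exprn_ge0.
  have -> : W * 2 ^+ K * x%:R ^+ K * (x%:R ^+ (s - K) / (s - K)`!%:R) =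
     (W * x%:R ^+ s) * (2 ^+ K / (s - K)`!%:R).
    by rewrite -[in x%:R ^+ s](subnKC (leq_trans KS' Ss)) exprD; ring.
  rewrite (_ : s%:R ^+ k * _ = (W * x%:R ^+ s) * (s%:R ^+ k / s`!%:R)); last by ring.
  by apply: ler_wpM2l (powfact s Ss); rewrite mulr_ge0 ?exprn_ge0.
rewrite -mulr_sumr.
have -> : \sum_(S <= s < T) x%:R ^+ (s - K) / (s - K)`!%:R =
    \sum_(S - K <= u < T - K) x%:R ^+ u / u`!%:R :> R.
  rewrite -{1}(subnK KS') -{1}(subnK (leq_trans KS' ST)) big_addn addnK.
  by apply: eq_bigr => u _; rewrite addnK.
apply: le_trans (ler_wpM2l _ (exp_tail_bound _ xSK)) _; first by rewrite !mulr_ge0 ?exprn_ge0.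
by rewrite le_eqVlt; apply/orP; left; apply/eqP; rewrite -{3}(subnKC KS') exprD; ring.
Qed.

End SeriesValues.

Lemma value_one (R : realType) (h : nat -> R) (v : R) :
  (forall s, h s = (s == 0%N)%:R) -> \sum_(s < T) h s @[T --> \oo] --> v -> v = 1.
Proof.
move=> h1 hv; have one : \sum_(s < T) h s @[T --> \oo] --> (1 : R).
  rewrite -cvg_shiftS /= (_ : (fun T => _) = fun=> 1); first exact: cvg_cst.
  by apply/funext => T; rewrite big_ord_recl h1 big1 ?addr0 // => s _; rewrite h1.
by rewrite -(cvg_lim (@Rhausdorff R) hv) (cvg_lim (@Rhausdorff R) one).
Qed.

(** * Linear independence over the rationals of the values at 1 *)

Section ValuesFree.
Variables (R : realType) (N' : nat).
Local Notation N := N'.+2.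
Variables (lam : 'I_N -> R) (A : 'M[R]_N) (rho : 'I_N -> nat).
Variables (f : 'I_N -> nat -> R) (v : 'I_N -> R) (c E : nat) (i0 : 'I_N).
Hypothesis sys : triangular_system lam A rho f.
Hypothesis lam_int : forall i, lam i \is a Num.int.
Hypothesis A_int : forall i j, A i j \is a Num.int.
Hypothesis f_free : series_free f.
Hypothesis c0 : (0 < c)%N.
Hypothesis f_bound : forall i s, `|f i s| <= c%:R ^+ s / s`!%:R.
Hypothesis f_int : forall i s T, (s <= T)%N ->
  (lcm_upto T ^ E * s`!)%:R * f i s \is a Num.int.
Hypothesis f1 : forall s, f i0 s = (s == 0%N)%:R.
Hypothesis f_cvg : forall i, \sum_(s < T) f i s @[T --> \oo] --> v i.

Let v1 : v i0 = 1 := value_one f1 (@f_cvg i0).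

Let smul_f1 p s : smul p (f i0) s = p`_s.
Proof.
rewrite /smul big_ord_recr /= subnn f1 eqxx mulr1 big1 ?add0r // => j _.
by rewrite f1 subn_eq0 leqNgt ltn_ord mulr0.
Qed.

Lemma values_free_ge2 (a : 'rV[R]_N) : (forall i, a 0 i \is a Num.int) ->
  \sum_i a 0 i * v i = 0 -> a = 0.
Proof.
move=> a_int av; apply/eqP; apply: contraT => a0.
have natb (x : R) : exists L : nat, x <= L%:R.
  exists (Num.bound `|x|); apply: le_trans (ler_norm _) _; apply: ltW; exact: archi_boundP.
have [L Lb] : exists L : nat, forall i, `|lam i| + \sum_j `|A^T i j| <= L%:R.
  have [L Lb] := natb (\sum_i (`|lam i| + \sum_j `|A^T i j|)); exists L => i.
  apply: le_trans Lb; rewrite [leRHS](bigD1 i) //= lerDl; apply: sumr_ge0 => k _.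
  by apply: addr_ge0 => //; apply: sumr_ge0.
have [am amb] : exists am : nat, forall i, `|a 0 i| <= am%:R.
  have [am amb] := natb (\sum_i `|a 0 i|); exists am => i.
  by apply: le_trans amb; rewrite [leRHS](bigD1 i) //= lerDl; apply: sumr_ge0.
have [C hC] := series_free_order f_free.
have [n [S [e [K [B [G [[SM Se] [detS KN] [KS cS] [EB EG] fin]]]]]]] :=
  parameter_choice N' c E L am C.
have [P [P0 Pn Pc PS Pb]] := auxiliary_form c0 f_bound f_int SM Se EB.
pose Pk k := iter k (connection lam A^T) P.
have det0 := det_krylov_neq0 sys hC P0 Pn PS detS.
(* Since [f i0] is the constant series 1, the bound of [krylov_order] on the product with [f i0] is
   one on the determinant itself. *)
have [|q [b [Edet b1 qS]]] := order_at_one det0 _ (size_det_krylov lam A^T Pn) (S := S).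
  by move=> s sS; rewrite -smul_f1; exact: (krylov_order i0 sys PS sS).
have kK k : (k < N + q)%N -> (k <= K)%N.
  by move: qS KN; rewrite -ltnS; clear; lia.
have At_int i j : A^T i j \is a Num.int by rewrite mxE.
have Wn : 0 <= (n`! * B)%:R :> R by rewrite ler0n.
have PkX k i : (k <= K)%N -> (Pk k 0 i).[1] \is a Num.int /\
    `|(Pk k 0 i).[1]| <= (G ^ K.+1 * (n`! * B))%:R.
  move=> kK'; have kG : (n.+1 + k + L <= G)%N by rewrite EG leq_add2r leq_add2l.
  have [int1 bnd1] := horner1_bound (size_iter_connection lam A^T k Pn i)
    (iter_connection_bound lam_int At_int Lb Pn kG Pc i).
  split=> //; apply: le_trans bnd1 _; rewrite -natrX -!natrM ler_nat mulnA leq_mul2r.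
  apply/orP; right; apply: (@leq_trans (G ^ k.+1)%N).
    by rewrite expnS leq_mul2r (leq_trans _ kG) ?orbT // leq_addr.
  by rewrite leq_pexp2l // EG.
pose Y : R := 2 * (N * (n`! * B))%:R * 2 ^+ K * c.+1%:R ^+ S / (S - K)`!%:R.
have Y0 : 0 <= Y.
  by rewrite divr_ge0 ?ler0n // mulr_ge0 ?exprn_ge0 // mulr_ge0 ?exprn_ge0 // mulr_ge0.
have PkY k : (k <= K)%N -> `|\sum_i (Pk k 0 i).[1] * v i| <= Y.
  move=> kK'; apply: (@cvg_norm_le _ (fun T => \sum_(s < T) comb (Pk k) f s) _ _ (comb_cvg f_cvg)) => T.
  rewrite (eq_bigr (fun s : 'I_T => (s : nat)%:R ^+ k * comb P f s)); last first.
    by move=> s _; rewrite (comb_iter_connection _ _ _ sys).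
  exact: (weighted_tail_bound _ PS Pb KS cS kK').
(* The first N + q forms have rank N at 1, so N rows can be selected; by [kK] their orders of
   derivation do not exceed [K]. *)
pose M : 'M[R]_(N + q, N) := \matrix_(k, i) (Pk k 0 i).[1].
have Mfull : row_full M.
  rewrite /row_full -mxrank_tr -/(row_free M^T) -kermx_eq0; apply/rowV0P => y /sub_kermxP yM.
  apply/rowP => i; rewrite mxE; apply: (rank_at_one (y := fun i => y 0 i) Edet b1) => k kNq.
  have := congr1 (fun Q : 'rV_(N + q) => Q 0 (Ordinal kNq)) yM; rewrite !mxE => yM0.
  by rewrite -[RHS]yM0; apply: eq_bigr => l _; rewrite !mxE mulrC.
pose U := rowsub (fullrankfun Mfull) M.
have UE i k : U i k = (Pk (fullrankfun Mfull i) 0 k).[1] by rewrite !mxE.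
have [j detj] := det_replace_row (fullrowsub_unit Mfull) a0.
have det_int : \det (replace_row U a j) \is a Num.int.
  apply: rpred_sum => s _; rewrite rpredMsign; apply: rpred_prod => i _.
  by rewrite mxE; case: ifP => // _; rewrite UE; apply: (PkX _ _ (kK _ _)).1.
have := norm_intr_ge1 det_int detj; rewrite leNgt => /negP[].
apply: le_lt_trans (det_replace_row_bound (X := (G ^ K.+1 * (n`! * B))%:R) (Y := Y)
  (am := am%:R) j Y0 _ amb v1 av _) _.
- by move=> i k; rewrite UE; apply: (PkX _ _ (kK _ _)).2.
- move=> i; rewrite (eq_bigr (fun k => (Pk (fullrankfun Mfull i) 0 k).[1] * v k)).
    by apply: PkY; apply: kK.
  by move=> k _; rewrite UE.
rewrite /Y !mulrA ltr_pdivrMr ?ltr0n ?fact_gt0 // mul1r.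
rewrite -!natrX -!natrM ltr_nat; apply: leq_ltn_trans fin.
by rewrite !mulnA.
Qed.

End ValuesFree.

Theorem values_free (R : realType) (N : nat) (lam : 'I_N -> R) (A : 'M[R]_N) (rho : 'I_N -> nat)
    (f : 'I_N -> nat -> R) (v : 'I_N -> R) (c E : nat) (i0 : 'I_N) (a : 'rV[R]_N) :
  triangular_system lam A rho f ->
  (forall i, lam i \is a Num.int) -> (forall i j, A i j \is a Num.int) ->
  series_free f -> (0 < c)%N -> (forall i s, `|f i s| <= c%:R ^+ s / s`!%:R) ->
  (forall i s T, (s <= T)%N -> (lcm_upto T ^ E * s`!)%:R * f i s \is a Num.int) ->
  (forall s, f i0 s = (s == 0%N)%:R) ->
  (forall i, \sum_(s < T) f i s @[T --> \oo] --> v i) ->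
  (forall i, a 0 i \is a Num.int) -> \sum_i a 0 i * v i = 0 -> a = 0.
Proof.
case: N lam A rho f v i0 a => [|[|N']] lam A rho f v i0 a; first by case: i0.
  (* With N = 1 the only series is the constant 1, so its value is 1 and the relation reads a =
     0. *)
  move=> _ _ _ _ _ _ _ f1 fv _; rewrite big_ord1 (ord1 i0) in f1 *.
  rewrite (value_one f1 (fv _)) mulr1 => a00.
  by apply/rowP => i; rewrite (ord1 i) mxE.
move=> sys lam_int A_int f_free c0 fb fi f1 fv aint av.
exact: (values_free_ge2 sys lam_int A_int f_free c0 fb fi f1 fv aint av).
Qed.

(** * The system of monomials *)

Section Monomials.
Variables (R : realType) (m : nat).
Local Notation expo := (multinom m.+1).
Implicit Types (e : expo) (j : 'I_m.+1) (l : 'I_m) (s T : nat).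

(* For j > 0 the coefficient of index 0 is 1 / 0 = 0. *)
Definition basic (j s : nat) : R := (-1) ^+ s / (s%:R ^+ j * s`!%:R).

Lemma basic0S s : basic 0 s.+1 *+ s.+1 = - basic 0 s.
Proof.
rewrite /basic !expr0 !mul1r factS natrM exprS -mulr_natr; field.
by rewrite natr_fact_neq0 nat1r pnatr_eq0.
Qed.

Lemma basicS (j s : nat) : basic j.+1 s *+ s = basic j s - ((j == 0%N) && (s == 0%N))%:R.
Proof.
rewrite /basic; case: s => [|s].
  rewrite mulr0n fact0 expr0 mulr1 mul1r expr0n.
  by case: j => [|j] /=; rewrite ?invr1 ?subrr // invr0 subr0.
have a0 : s.+1%:R != 0 :> R by rewrite pnatr_eq0.
have b0 : s.+1%:R ^+ j != 0 :> R by rewrite expf_neq0.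
rewrite andbF subr0 [_ ^+ j.+1]exprS -[LHS]mulr_natr.
move: ((-1) ^+ _) s.+1%:R a0 (_ ^+ j) b0 (natr_fact_neq0 R s.+1) => x a a0 b b0.
by move: (_`!%:R) => f f0; field; rewrite a0 b0 f0.
Qed.

(** Truncated polynomials replace products of power series: the s-th coefficient of a product
    depends only on its factors up to z^s, so any truncation beyond s gives the same value
    ([mono_seriesE]). *)
Definition basic_trunc T (j : nat) : {poly R} := \poly_(k < T) basic j k.
Definition mono_trunc T e : {poly R} := \prod_(j < m.+1) basic_trunc T j ^+ e j.
Definition mono_series e s : R := (mono_trunc s.+1 e)`_s.

Lemma mono_truncD T e e' : mono_trunc T (mnm_add e e') = mono_trunc T e * mono_trunc T e'.
Proof. by rewrite -big_split; apply: eq_bigr => j _; rewrite mnmDE exprD. Qed.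

Lemma mono_trunc0 T : mono_trunc T mnm0 = 1.
Proof. by apply: big1 => j _; rewrite mnm0E. Qed.

Lemma mono_trunc1 T j : mono_trunc T (mnm1 j) = basic_trunc T j.
Proof.
rewrite /mono_trunc (bigD1 j) //= mnm1E eqxx expr1 big1 ?mulr1 // => k kj.
by rewrite mnm1E eq_sym (negPf kj).
Qed.

Lemma mnm_subK e j : e j != 0%N -> mnm_add (mnm_sub e (mnm1 j)) (mnm1 j) = e.
Proof. by move=> ej; apply: submK; rewrite lep1mP. Qed.

Definition agree s (p q : {poly R}) := forall k, (k <= s)%N -> p`_k = q`_k.

Lemma agreeM s p q p' q' : agree s p p' -> agree s q q' -> agree s (p * q) (p' * q').
Proof.
move=> pp qq k ks; rewrite !coefM; apply: eq_bigr => i _; rewrite pp ?qq //.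
  by rewrite (leq_trans (leq_subr _ _)).
by rewrite (leq_trans _ ks) // -ltnS.
Qed.

Lemma mono_seriesE T e s : (s < T)%N -> mono_series e s = (mono_trunc T e)`_s.
Proof.
move=> sT; suff: agree s (mono_trunc s.+1 e) (mono_trunc T e) by exact.
rewrite /mono_trunc; elim/big_ind2: _ => // [p p' q q'|j _]; first exact: agreeM.
elim: (e j) => [//|d IH]; rewrite !exprS; apply: agreeM => // k ks.
by rewrite !coef_poly ltnS ks (leq_ltn_trans ks).
Qed.

Lemma eulerD_mono_trunc T e : eulerD (mono_trunc T e) =
  \sum_(j < m.+1) (e j)%:R *: (eulerD (basic_trunc T j) * mono_trunc T (mnm_sub e (mnm1 j))).
Proof.
have [d] := ubnP (mdeg e); elim: d e => // d IH e; rewrite ltnS => ed.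
case: (eqVneq e mnm0) => [->|e0].
  rewrite mono_trunc0 [RHS]big1 => [|j _]; last by rewrite mnm0E scale0r.
  by rewrite /eulerD derivC mulr0.
have [k ek] : exists k, e k != 0%N.
  apply/existsP; apply: contraNT e0; rewrite negb_exists => /forallP all0.
  by apply/eqP/mnmP => j; rewrite mnm0E; apply/eqP; move: (all0 j); rewrite negbK.
have Ee := mnm_subK ek; set e' := mnm_sub e (mnm1 k) in Ee.
have e'd : (mdeg e' < d)%N.
  by apply: leq_trans ed; rewrite -Ee mdegD mdeg1 addn1.
clearbody e'.
rewrite -Ee mono_truncD mono_trunc1 eulerDM (IH e' e'd) mulr_suml.
rewrite [RHS](eq_bigr (fun j => (e' j)%:R *:
     (eulerD (basic_trunc T j) * mono_trunc T (mnm_sub e' (mnm1 j))) * basic_trunc T k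
   + (k == j)%:R *: (eulerD (basic_trunc T j) * mono_trunc T e'))); last first.
  move=> j _; rewrite mnmDE mnm1E natrD scalerDl; congr (_ + _); last first.
    case: eqP => [<-|_]; last by rewrite !scale0r.
    by congr (_ *: (_ * mono_trunc T _)); apply: addmK.
  case: (eqVneq (e' j) 0%N) => [->|ej]; first by rewrite !scale0r mul0r.
  rewrite -scalerAl -[in RHS]mulrA -(mono_trunc1 T k) -mono_truncD; congr (_ *: (_ * mono_trunc T _)).
  apply/mnmP => i; rewrite !(mnmBE, mnmDE, mnm1E); move: ej.
  by case: (eqVneq j i) => [->|_]; case: (k == i) => /= ; lia.
rewrite big_split /=; congr (_ + _); rewrite (bigD1 k) //= eqxx scale1r big1 ?addr0 1?mulrC //.
by move=> j jk; rewrite eq_sym (negPf jk) scale0r.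
Qed.

(** [lift ord0 l] is the index of g_(l+1). Differentiating one such factor turns it into g_l, which
    is [shift]; for l = 0 it becomes f - 1, and the term -1 simply removes the factor, which is
    [shift_down]. *)
Definition shift_down e l := mnm_sub e (mnm1 (lift ord0 l)).
Definition shift e l := mnm_add (shift_down e l) (mnm1 (widen_ord (leqnSn m) l)).

Lemma mono_series_eq e s : mono_series e s *+ s =
  - (e ord0)%:R * smul 'X (mono_series e) s +
  \sum_(l < m) (e (lift ord0 l))%:R * (mono_series (shift e l) s
    - (l == 0 :> nat)%:R * mono_series (shift_down e l) s).
Proof.
have trE f : mono_series f s = (mono_trunc s.+1 f)`_s by apply: mono_seriesE.
rewrite {1}trE -coef_eulerD eulerD_mono_trunc coef_sum big_ord_recl; congr (_ + _).
  rewrite coefZ mulNr; case: (eqVneq (e ord0) 0%N) => [->|e0]; first by rewrite !mul0r oppr0.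
  rewrite -mulrN; congr (_ * _).
  have ag : agree s (eulerD (basic_trunc s.+1 0)) (- ('X * basic_trunc s.+1 0)).
    move=> k ks; rewrite coef_eulerD coefN coefXM !coef_poly ltnS ks.
    case: k ks => [|k] ks; first by rewrite mulr0n oppr0.
    by rewrite basic0S ltnW //= ltnS ltnW.
  rewrite (@agreeM _ _ (mono_trunc s.+1 (mnm_sub e (mnm1 ord0))) _ _ ag (fun _ _ => erefl) _ (leqnn s)).
  rewrite mulNr coefN -mulrA mulrC; congr (- _).
  have -> : basic_trunc s.+1 0 * mono_trunc s.+1 (mnm_sub e (mnm1 ord0)) = mono_trunc s.+1 e.
    by rewrite -[in RHS](mnm_subK e0) mono_truncD mono_trunc1 mulrC.
  rewrite coefMX smulX; case: s {trE ag} => // s /=.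
  by rewrite (@mono_seriesE s.+2).
apply: eq_bigr => l _; rewrite coefZ; congr (_ * _); rewrite !trE.
have -> : eulerD (basic_trunc s.+1 (lift ord0 l)) = basic_trunc s.+1 l - (l == 0 :> nat)%:R%:P.
  apply/polyP => k; rewrite coef_eulerD coefB coefC !coef_poly lift0.
  case: ifP => ks; first by rewrite basicS; case: (k == 0%N); rewrite ?andbT ?andbF.
  by rewrite mul0rn; case: k ks => // k _; rewrite subrr.
rewrite mulrBl coefB coefCM; congr (_ - _); rewrite /shift mono_truncD mono_trunc1 mulrC //.
Qed.

End Monomials.

(** * Size and denominators of the coefficients *)

Section CoefficientArithmetic.
Variable R : realType.
Implicit Types p q : {poly R}.

Definition coef_exp_bound (a : nat) p := forall s, `|p`_s| <= a%:R ^+ s / s`!%:R.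

Lemma coef_exp_boundM a b p q :
  coef_exp_bound a p -> coef_exp_bound b q -> coef_exp_bound (a + b) (p * q).
Proof.
move=> pa qb s; rewrite coefM; apply: le_trans (ler_norm_sum _ _ _) _.
rewrite natrD addrC exprDn mulr_suml; apply: ler_sum => k _.
have ks : (k <= s)%N by rewrite -ltnS.
rewrite normrM; apply: le_trans (ler_pM _ _ (pa k) (qb (s - k)%N)) _ => //.
rewrite -[_ *+ 'C(s, k)]mulr_natr natr_bin // le_eqVlt; apply/orP; left; apply/eqP.
by field; rewrite !natr_fact_neq0.
Qed.

Lemma coef_exp_bound1 : coef_exp_bound 0 1.
Proof. by case=> [|s]; rewrite coef1 ?eqxx ?normr1 ?expr0 ?fact0 ?divr1 // normr0 expr0n mul0r. Qed.

Definition lcm_integral (T E : nat) p := forall s, (s <= T)%N ->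
  (lcm_upto T ^ E * s`!)%:R * p`_s \is a Num.int.

Lemma lcm_integralM T E E' p q :
  lcm_integral T E p -> lcm_integral T E' q -> lcm_integral T (E + E') (p * q).
Proof.
move=> pE qE s sT; rewrite coefM mulr_sumr; apply: rpred_sum => k _.
have ks : (k <= s)%N by rewrite -ltnS.
have -> : (lcm_upto T ^ (E + E') * s`!)%:R * (p`_k * q`_(s - k)) = 'C(s, k)%:R *
   (((lcm_upto T ^ E * k`!)%:R * p`_k) * ((lcm_upto T ^ E' * (s - k)`!)%:R * q`_(s - k))).
  by rewrite -(bin_fact ks) expnD !natrM; ring.
rewrite rpredM ?natr_int // rpredM ?pE ?qE //; last by rewrite (leq_trans (leq_subr _ _)).
exact: leq_trans sT.
Qed.

Lemma lcm_integral1 T : lcm_integral T 0 1.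
Proof. by move=> s _; rewrite coef1 rpredM ?natr_int. Qed.

Lemma lcm_integral_mono T E E' p : (E <= E')%N -> lcm_integral T E p -> lcm_integral T E' p.
Proof.
move=> EE pE s sT; rewrite -(subnK EE) expnD -mulnA natrM -mulrA rpredM ?natr_int //.
exact: pE.
Qed.

Variable m : nat.

Lemma basic_trunc_bound T j : coef_exp_bound 1 (basic_trunc R T j).
Proof.
move=> s; rewrite coef_poly expr1n; case: ifP => _; last by rewrite normr0 divr_ge0 ?ler0n.
rewrite normrM normrX normrN1 expr1n invfM normrM !mul1r.
rewrite !normfV normrX !normr_nat ler_piMl ?invr_ge0 ?ler0n //.
case: s => [|s]; first by rewrite expr0n; case: (j == 0%N); rewrite /= ?invr1 ?invr0 ?ler01.
by rewrite invf_le1 ?exprn_gt0 ?ltr0n // exprn_ege1 // ler1n.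
Qed.

Lemma basic_trunc_integral T T' j : lcm_integral T j (basic_trunc R T' j).
Proof.
move=> s sT; rewrite coef_poly; case: ifP => _; last by rewrite mulr0.
case: s sT => [|s] sT.
  rewrite /basic expr0n expr0; case: j => [|j] /=; last by rewrite mul0r invr0 mulr0 mulr0.
  by rewrite fact0 !mulr1n !mul1r invr1 rpred1.
have /dvdnP[k Ek] := dvdn_lcm_upto (isT : 0 < s.+1)%N sT.
rewrite /basic Ek expnMn natrM (natrM _ (k ^ j)%N) !natrX.
have a0 : s.+1%:R ^+ j != 0 :> R by rewrite expf_neq0 // pnatr_eq0.
have -> : k%:R ^+ j * s.+1%:R ^+ j * (s.+1)`!%:R * ((-1) ^+ s.+1 / (s.+1%:R ^+ j * (s.+1)`!%:R))
    = k%:R ^+ j * (-1) ^+ s.+1 :> R.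
  move: (s.+1%:R ^+ j) a0 (natr_fact_neq0 R s.+1) ((-1) ^+ s.+1) => a a0 f0 x.
  by move: (_`!%:R) f0 => f f0; field; rewrite a0 f0.
by rewrite rpredM ?rpredX ?natr_int // rpredN rpred1.
Qed.

Lemma mono_trunc_bound T (e : multinom m.+1) : coef_exp_bound (mdeg e) (mono_trunc R T e).
Proof.
rewrite mdegE /mono_trunc.
elim/big_ind2: _ => [|a p b q|j _]; [exact: coef_exp_bound1|exact: coef_exp_boundM|].
elim: (e j) => [|d IH]; first exact: coef_exp_bound1.
rewrite exprS -add1n; apply: coef_exp_boundM IH; exact: basic_trunc_bound.
Qed.

(** It plays two roles: the exponent of the lcm that clears denominators, and a quantity that
    strictly decreases along the matrix of the system and so makes it triangular. *)
Definition weight (e : multinom m.+1) : nat := (\sum_(j < m.+1) j * e j)%N.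

Lemma mono_trunc_integral T T' (e : multinom m.+1) : lcm_integral T (weight e) (mono_trunc R T' e).
Proof.
rewrite /weight /mono_trunc.
elim/big_ind2: _ => [|a p b q|j _]; [exact: lcm_integral1|exact: lcm_integralM|].
elim: (e j) => [|d IH]; first by rewrite muln0; exact: lcm_integral1.
rewrite exprS mulnS; apply: lcm_integralM IH; exact: basic_trunc_integral.
Qed.

Lemma weight_le (e : multinom m.+1) : (weight e <= m * mdeg e)%N.
Proof.
rewrite mdegE big_distrr /=; apply: leq_sum => j _; rewrite leq_mul2r -ltnS ltn_ord orbT //.
Qed.

Lemma mono_series_bound (e : multinom m.+1) s :
  `|mono_series R e s| <= (mdeg e)%:R ^+ s / s`!%:R.
Proof. exact: mono_trunc_bound. Qed.

Lemma mono_series_integral (e : multinom m.+1) D s T : (mdeg e <= D)%N -> (s <= T)%N ->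
  (lcm_upto T ^ (m * D) * s`!)%:R * mono_series R e s \is a Num.int.
Proof.
move=> eD sT; apply: (lcm_integral_mono _ (@mono_trunc_integral T _ e)) => //.
by apply: leq_trans (weight_le e) _; rewrite leq_mul2l eD orbT.
Qed.

Lemma mono_series0 s : mono_series R (@mnm0 m.+1) s = (s == 0%N)%:R.
Proof. by rewrite /mono_series mono_trunc0 coef1. Qed.

End CoefficientArithmetic.

(** * The triangular system of monomials and its independence *)

Section MonomialSystem.
Variables (R : realType) (m D : nat).
Local Notation expo := (multinom m.+1).
Implicit Types (e : expo) (l : 'I_m).

Local Notation N := #|{: bmultinom m.+1 D.+1}|.
Definition expo_of (i : 'I_N) : expo := bmnm (enum_val i).

Lemma expo_of_inj : injective expo_of.
Proof. by move=> i k /val_inj /enum_val_inj. Qed.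

Lemma mdeg_expo_of i : (mdeg (expo_of i) <= D)%N.
Proof. by rewrite -ltnS bmdeg. Qed.

Lemma expo_ofP e : (mdeg e <= D)%N -> exists i, expo_of i = e.
Proof.
rewrite -ltnS => eD; exists (enum_rank (BMultinom eD)).
by rewrite /expo_of enum_rankK.
Qed.

Definition shift_coef e e' : R := \sum_l (e (lift ord0 l))%:R *
  ((e' == shift e l)%:R - ((l == 0 :> nat) && (e' == shift_down e l))%:R).

Definition mono_lam (i : 'I_N) : R := - (expo_of i ord0)%:R.
Definition mono_mx : 'M[R]_N := \matrix_(i, k) shift_coef (expo_of i) (expo_of k).
(** The weight comes first, and the index i < N breaks ties, as ranks must be distinct. *)
Definition mono_rank (i : 'I_N) : nat := (weight (expo_of i) * N + i)%N.

Lemma sum_expo_of e (F : expo -> R) : (mdeg e <= D)%N ->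
  \sum_k (expo_of k == e)%:R * F (expo_of k) = F e.
Proof.
move=> /expo_ofP[i <-]; rewrite (bigD1 i) //= eqxx mul1r big1 ?addr0 // => k ki.
by rewrite (inj_eq expo_of_inj) (negPf ki) mul0r.
Qed.

Lemma weightD e e' : weight (mnm_add e e') = (weight e + weight e')%N.
Proof. by rewrite -big_split; apply: eq_bigr => j _; rewrite mnmDE mulnDr. Qed.

Lemma weight1 (j : 'I_m.+1) : weight (mnm1 j) = j.
Proof.
rewrite /weight (bigD1 j) //= mnm1E eqxx muln1 big1 ?addn0 // => k kj.
by rewrite mnm1E eq_sym (negPf kj) muln0.
Qed.

Lemma shift_downK e l : e (lift ord0 l) != 0%N ->
  mnm_add (shift_down e l) (mnm1 (lift ord0 l)) = e.
Proof. exact: mnm_subK. Qed.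

Lemma weight_shift_down e l : e (lift ord0 l) != 0%N ->
  (weight (shift_down e l) + l.+1)%N = weight e.
Proof. by move=> el; rewrite -[in RHS](shift_downK el) weightD weight1 lift0. Qed.

Lemma mdeg_shift_down e l : (mdeg (shift_down e l) <= mdeg e)%N.
Proof. exact: mdegB. Qed.

Lemma mdeg_shift e l : e (lift ord0 l) != 0%N -> mdeg (shift e l) = mdeg e.
Proof. by move=> el; rewrite -[in RHS](shift_downK el) !mdegD !mdeg1. Qed.

Lemma shift_coef_weight e e' : shift_coef e e' != 0 -> (weight e' < weight e)%N.
Proof.
move=> h; rewrite ltnNge; apply: contra h => ee'; apply/eqP/big1 => l _.
case: (eqVneq (e (lift ord0 l)) 0%N) => [->|el]; first by rewrite mul0r.
have wl := weight_shift_down el.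
have -> : (e' == shift e l) = false.
  by apply/eqP => E; move: ee'; rewrite E weightD weight1 -wl /= addnS ltnn.
have -> : (e' == shift_down e l) = false.
  by apply/eqP => E; move: ee'; rewrite E -wl addnS ltnNge leq_addr.
by rewrite andbF subrr mulr0.
Qed.

Lemma mono_triangular_system :
  triangular_system mono_lam mono_mx mono_rank (fun i => mono_series R (expo_of i)).
Proof.
split.
- move=> i k E; apply/val_inj; have := congr1 (modn^~ N) E.
  by rewrite /mono_rank !modnMDl !modn_small.
- move=> i k; rewrite mxE => /shift_coef_weight ki; rewrite /mono_rank.
  apply: (@leq_trans ((weight (expo_of k)).+1 * N)%N).
    by rewrite mulSn addnC ltn_add2r.
  by apply: leq_trans (leq_addr _ _); rewrite leq_mul2r ki orbT.
- move=> i s; rewrite mono_series_eq; congr (_ + _).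
  set e := expo_of i; have eD : (mdeg e <= D)%N := mdeg_expo_of i.
  transitivity (\sum_l \sum_k (e (lift ord0 l))%:R * ((expo_of k == shift e l)%:R
     - ((l == 0 :> nat) && (expo_of k == shift_down e l))%:R) * mono_series R (expo_of k) s).
    apply: eq_bigr => l _; case: (eqVneq (e (lift ord0 l)) 0%N) => [->|el].
      by rewrite mul0r big1 // => k _; rewrite !mul0r.
    rewrite -(sum_expo_of (fun e => mono_series R e s) (_ : mdeg (shift e l) <= D)%N) ?mdeg_shift //.
    rewrite -(sum_expo_of (fun e => mono_series R e s) (_ : mdeg (shift_down e l) <= D)%N); last first.
      exact: leq_trans (mdeg_shift_down e l) eD.
    rewrite mulr_sumr -sumrB mulr_sumr; apply: eq_bigr => k _.
    rewrite -mulrA mulrBl mulrA -natrM mulnb; congr (_ * (_ - _)).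
  rewrite exchange_big; apply: eq_bigr => k _; by rewrite mxE mulr_suml.
Qed.

Lemma mono_series_at0 e : (forall l, e (lift ord0 l) = 0%N) -> mono_series R e 0 = 1.
Proof.
move=> e0; rewrite /mono_series /mono_trunc big_ord_recl big1 ?mulr1 => [|l _]; last first.
  by rewrite e0.
rewrite -horner_coef0 horner_exp horner_coef0 coef_poly /= /basic.
by rewrite !expr0 fact0 mulr1n !mul1r invr1 expr1n.
Qed.

(** On an eigenvector the exponent of f is constant over the support. Being killed by the matrix
    then forces the exponents of g_1, g_2, ... to vanish on the support one after another. A single
    power of f remains, and its constant term is 1. *)
Lemma mono_series_free : series_free (fun i => mono_series R (expo_of i)).
Proof.
apply: (triangular_series_free mono_triangular_system) => c mu c0 cmu cA.
have same0 i k : c 0 i != 0 -> c 0 k != 0 -> expo_of i ord0 = expo_of k ord0.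
  move=> ci ck; case: (cmu i) => [/eqP|]; first by rewrite (negPf ci).
  case: (cmu k) => [/eqP|<-]; first by rewrite (negPf ck).
  by move=> /oppr_inj /eqP; rewrite eqr_nat => /eqP.
have vanish l i : c 0 i != 0 -> expo_of i (lift ord0 l) = 0%N.
  have [d] := ubnP (l : nat); elim: d l i => // d IH l i; rewrite ltnS => ld ci.
  apply/eqP; apply: contraT => el; set e := expo_of i in el.
  (* The condition is read in the column of the monomial where one g_(l+1) of [e] has become g_l.
     Only row [i] contributes there, with the nonzero value c_i e_(l+1). *)
  have [i' Ei'] : exists i', expo_of i' = shift e l.
    by apply: expo_ofP; rewrite mdeg_shift // mdeg_expo_of.
  (* No other exponent in the support of c contributes to the coefficient of
     the monomial shift e l, since it would have a larger exponent at the index before l. *)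
  have other k l' : c 0 k != 0 -> expo_of k (lift ord0 l') != 0%N ->
      shift e l = shift (expo_of k) l' -> k = i /\ l' = l.
    move=> ck kl' E; have E2 : mnm_add e (mnm_add (mnm1 (widen_ord (leqnSn m) l)) (mnm1 (lift ord0 l')))
       = mnm_add (expo_of k) (mnm_add (mnm1 (widen_ord (leqnSn m) l')) (mnm1 (lift ord0 l))).
      rewrite -{1}(shift_downK el) -{1}(shift_downK kl'); apply/mnmP => j.
      move/mnmP/(_ j): E; rewrite /shift !mnmDE; lia.
    have ll' : (l <= l')%N.
      rewrite leqNgt; apply/negP => l'l; case/eqP: kl'; apply: IH ck.
      exact: leq_trans l'l ld.
    move: ll'; rewrite leq_eqVlt => /orP[/eqP/val_inj ll|ll'].
      split=> //; apply/expo_of_inj; move: E2; rewrite ll => /addIm; exact: esym.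
    exfalso; have := (mnmP _ _).1 E2 (widen_ord (leqnSn m) l).
    rewrite !(mnmDE, mnm1E) eqxx -!val_eqE /= /bump /= !add1n.
    rewrite (gtn_eqF ll') (gtn_eqF (leqW ll')) (gtn_eqF (ltnSn l)) !addn0 [X in (e _ + X)%N = _](_ : _ = 1%N) //.
    have s0 : e ord0 = expo_of k ord0 := same0 i k ci ck.
    case: (posnP l) => [l0|l0].
      rewrite (_ : widen_ord _ l = ord0); last exact/val_inj.
      by rewrite s0 => /eqP; rewrite -[X in _ == X]addn0 eqn_add2l.
    have [l1 El1] : exists l1 : 'I_m, l = l1.+1 :> nat.
      have lt : (l.-1 < m)%N by apply: leq_ltn_trans (ltn_ord l); rewrite leq_pred.
      by exists (Ordinal lt); rewrite /= prednK.
    rewrite (_ : widen_ord _ l = lift ord0 l1); last by apply/val_inj; rewrite /= El1.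
    have l1l : (l1 < d)%N by rewrite El1 in ld.
    by rewrite (IH l1 k l1l ck) (IH l1 i l1l ci : e _ = _).
  (* Removing a factor g_1 keeps the exponent of f, whereas the shift with l = 0 raises it, and that
     exponent is the same throughout the support. *)
  have down k l' : c 0 k != 0 -> expo_of k (lift ord0 l') != 0%N -> l' = 0%N :> nat ->
      shift e l <> shift_down (expo_of k) l'.
    move=> ck kl' l'0 E; have l0 : l = 0%N :> nat.
      apply/eqP; apply: contraT => l0; case/eqP: kl'; apply: IH ck.
      by rewrite l'0 (leq_trans _ ld) // lt0n.
    have := (mnmP _ _).1 E ord0; rewrite /shift /shift_down !(mnmDE, mnmBE, mnm1E).
    rewrite -!val_eqE /= l0 (same0 i k ci ck : e _ = _) !subn0 => /eqP.
    by rewrite -[X in _ == X]addn0 eqn_add2l.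
  have := cA i'; rewrite (bigD1 i) //= mxE Ei' big1 => [|k ki].
    rewrite /shift_coef (bigD1 l) //= eqxx big1 => [|l' l'l].
      rewrite (_ : (shift e l == shift_down e l) = false) ?andbF ?subr0 ?mulr1 ?addr0.
        by move/eqP; rewrite mulf_eq0 (negPf ci) pnatr_eq0 (negPf el).
      apply/eqP => E; have := congr1 (@mdeg _) E; rewrite mdegD mdeg1 => /eqP.
      by rewrite -[X in _ == X]addn0 eqn_add2l.
    case: (eqVneq (e (lift ord0 l')) 0%N) => [->|el']; first by rewrite mul0r.
    case: (eqVneq (shift e l) (shift e l')) => [/(other _ _ ci el')[_ /eqP]|_].
      by rewrite (negPf l'l).
    case: eqP => l'0; last by rewrite subrr mulr0.
    by rewrite (_ : (_ == _) = false) ?subrr ?mulr0 //; apply/eqP; exact: down.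
  case: (eqVneq (c 0 k) 0) => [->|ck]; first by rewrite mul0r.
  rewrite mxE Ei' /shift_coef big1 ?mulr0 // => l' _.
  case: (eqVneq (expo_of k (lift ord0 l')) 0%N) => [->|kl']; first by rewrite mul0r.
  case: (eqVneq (shift e l) (shift (expo_of k) l')) => [/(other _ _ ck kl')[/eqP]|_].
    by rewrite (negPf ki).
  case: eqP => l'0; last by rewrite subrr mulr0.
  by rewrite (_ : (_ == _) = false) ?subrr ?mulr0 //; apply/eqP; exact: down.
have /rV0Pn[i ci] := c0; exists 0%N.
rewrite (bigD1 i) //= big1 ?addr0 => [|k ki].
  by rewrite mono_series_at0 ?mulr1 // => l; exact: vanish.
case: (eqVneq (c 0 k) 0) => [->|ck]; first by rewrite mul0r.
case/eqP: ki; apply/expo_of_inj/mnmP => j.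
case: (unliftP ord0 j) => [l ->|->]; first by rewrite !vanish.
exact: same0.
Qed.

End MonomialSystem.

(** * Values of the monomials at 1 and the Eta constants *)

Section BasicValues.
Variable R : realType.

Definition basic_value (j : nat) : R := limn (series (basic R j)).

Lemma basic_norm_le j s : `|basic R j s| <= exp_coeff 1 s.
Proof.
have := basic_trunc_bound R s.+1 j s.
by rewrite coef_poly ltnSn /exp_coeff /=.
Qed.

Lemma basic_cvg j : \sum_(s < T) basic R j s @[T --> \oo] --> basic_value j.
Proof.
rewrite (_ : (fun T => _) = series (basic R j)).
  apply: normed_cvg; apply: series_le_cvg (is_cvg_series_exp_coeff 1) => s.
    exact: normr_ge0.
  exact: exp_coeff_ge0.
  exact: basic_norm_le.
by apply/funext => T; rewrite /series /= big_mkord.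
Qed.

Variable m : nat.
Implicit Types e : multinom m.+1.

Lemma mono_trunc_cvg e :
  (mono_trunc R T e).[1] @[T --> \oo] --> \prod_(j < m.+1) basic_value j ^+ e j.
Proof.
rewrite (_ : (fun T => _) = fun T => \prod_(j < m.+1) (\sum_(s < T) basic R j s) ^+ e j).
  apply: cvg_big => [|j _]; first exact: mul_continuous.
  elim: (e j) => [|d IH].
    by rewrite expr0 (_ : (fun T => _) = fun=> 1) //; exact: cvg_cst.
  rewrite exprS (_ : (fun T => _) = (fun T => \sum_(s < T) basic R j s) \*
    (fun T => (\sum_(s < T) basic R j s) ^+ d)).
    by apply: cvgM IH; exact: basic_cvg.
  by apply/funext => T; rewrite exprS.
apply/funext => T; rewrite /mono_trunc horner_prod; apply: eq_bigr => j _.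
rewrite horner_exp /basic_trunc horner_poly; congr (_ ^+ _).
by apply: eq_bigr => s _; rewrite expr1n mulr1.
Qed.

(** The truncated product at 1 converges to the product of the values. Its coefficients below [T]
    are those of the series, and the remaining ones are dominated by a tail of the exponential
    series at [mdeg e]. *)
Lemma mono_series_cvg e :
  \sum_(s < T) mono_series R e s @[T --> \oo] --> \prod_(j < m.+1) basic_value j ^+ e j.
Proof.
pose tail T := (mono_trunc R T e).[1] - \sum_(s < T) mono_series R e s.
suff tail0 : tail T @[T --> \oo] --> (0 : R).
  rewrite -[X in _ --> X]subr0 (_ : (fun T => _) = fun T => (mono_trunc R T e).[1] - tail T).
    by apply: cvgB => //; exact: mono_trunc_cvg.
  by apply/funext => T; rewrite /tail opprB addrC subrK.
have bnd T : (2 * mdeg e <= T)%N -> `|tail T| <= 2 * exp_coeff (mdeg e)%:R T.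
  move=> eT; pose U := maxn T (size (mono_trunc R T e)).
  have TU : (T <= U)%N by rewrite leq_maxl.
  have -> : tail T = \sum_(T <= s < U) (mono_trunc R T e)`_s.
    rewrite /tail (horner_coef_wide 1 (_ : (size (mono_trunc R T e) <= U)%N)) ?leq_maxr //.
    rewrite -(big_mkord xpredT (fun s => (mono_trunc R T e)`_s * 1 ^+ s)).
    rewrite (big_cat_nat (n := T)) //=.
    have -> : \sum_(0 <= s < T) (mono_trunc R T e)`_s * 1 ^+ s = \sum_(s < T) mono_series R e s.
      rewrite big_mkord; apply: eq_bigr => s _; by rewrite expr1n mulr1 (@mono_seriesE _ _ T).
    by rewrite addrAC subrr add0r; apply: eq_bigr => s _; rewrite expr1n mulr1.
  apply: le_trans (ler_norm_sum _ _ _) _; apply: le_trans (exp_tail_bound R U eT).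
  by apply: ler_sum => s _; exact: mono_trunc_bound.
have c0 : 2 * exp_coeff (mdeg e)%:R T @[T --> \oo] --> (0 : R).
  rewrite -[X in _ --> X](mulr0 2); apply: cvgMl_tmp.
  exact/cvg_series_cvg_0/is_cvg_series_exp_coeff.
apply/norm_cvg0P; apply: squeeze_cvgr (cvg_cst 0) c0.
near=> T; rewrite normr_ge0 bnd //; near: T; exact: nbhs_infty_ge.
Unshelve. all: by end_near.
Qed.

Theorem basic_values_free D (a : 'rV[R]_#|{: bmultinom m.+1 D.+1}|) :
  (forall i, a 0 i \is a Num.int) ->
  \sum_i a 0 i * \prod_(j < m.+1) basic_value j ^+ expo_of i j = 0 -> a = 0.
Proof.
have [i0 Ei0] : exists i0 : 'I_#|{: bmultinom m.+1 D.+1}|, expo_of i0 = mnm0.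
  by apply: expo_ofP; rewrite mdeg0.
apply: (values_free (c := D.+1) (E := m * D) (i0 := i0) (mono_triangular_system R m D)) => //.
- by move=> i; rewrite /mono_lam rpredN natr_int.
- move=> i k; rewrite mxE; apply: rpred_sum => l _.
  by rewrite rpredM ?natr_int // rpredB ?natr_int.
- exact: mono_series_free.
- move=> i s; apply: le_trans (mono_series_bound _ _ _) _.
  rewrite ler_wpM2r ?invr_ge0 ?ler0n // lerXn2r ?nnegrE ?ler0n // ler_nat.
  by rewrite leqW // mdeg_expo_of.
- by move=> i s T; apply: mono_series_integral; exact: mdeg_expo_of.
- by move=> s; rewrite Ei0 mono_series0.
- by move=> i; exact: mono_series_cvg.
Qed.

End BasicValues.

Lemma eta_constE (R : realType) n :
  eta_const R n = n`!%:R * ((n == 0%N)%:R - basic_value R n).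
Proof.
rewrite /eta_const mulNr -mulrN; congr (_ * _); rewrite -[RHS]opprB; congr (- _).
apply/cvg_lim; first exact: Rhausdorff.
rewrite -cvg_shiftS /=.
rewrite (_ : (fun T => _) = fun T => \sum_(s < T.+1) basic R n s - (n == 0%N)%:R).
  by apply: cvgB (cvg_cst _); have := @basic_cvg R n; rewrite -cvg_shiftS.
apply/funext => T; rewrite big_add1 /= big_mkord big_ord_recl.
(* The sum in [eta_const] starts at 1, so the term of index 0 is split off: it is 1 for n = 0 and 1
   / 0 = 0 otherwise. *)
have -> : basic R n (@ord0 T) = (n == 0%N)%:R.
  by rewrite /basic /= expr0n fact0 mulr1 expr0 mul1r; case: (n == 0%N); rewrite ?invr1 ?invr0.
by rewrite addrAC subrr add0r.
Qed.

(** * From algebraic to rational coefficients *)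

Lemma digits_inj n b (x y : 'I_n -> nat) : (forall i, x i < b)%N -> (forall i, y i < b)%N ->
  (\sum_i x i * b ^ i = \sum_i y i * b ^ i)%N -> x =1 y.
Proof.
elim: n x y => [|n IH] x y xb yb; first by move=> _ [].
have b0 : (0 < b)%N by apply: leq_ltn_trans (xb ord0).
have shiftE z : (\sum_(i < n) z (lift ord0 i) * b ^ lift ord0 i =
    (\sum_(i < n) z (lift ord0 i) * b ^ i) * b)%N.
  by rewrite big_distrl; apply: eq_bigr => i _; rewrite lift0 expnSr mulnA.
rewrite !big_ord_recl !shiftE expn0 !muln1 => E.
have e0 : x ord0 = y ord0.
  by have := congr1 (modn^~ b) E; rewrite /= !(addnC (_ ord0)) !modnMDl !modn_small.
have el : (fun i => x (lift ord0 i)) =1 (fun i => y (lift ord0 i)).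
  apply: IH => [i|i|] //; move/eqP: E; rewrite e0 eqn_add2l eqn_pmul2r //.
  by move/eqP.
by move=> j; case: (unliftP ord0 j) => [i ->|->]; [exact: el|].
Qed.

(* Kronecker substitution reduces the claim to one variable. *)
Lemma mpoly_nonzero_point (F : numFieldType) n (p : mpoly n F) : p != 0 ->
  exists y : 'I_n -> nat, meval (fun i => (y i)%:R) p != 0.
Proof.
move=> p0; have [e0 pe0] : exists e0, mcoeff e0 p != 0.
  apply/not_existsP => all0; case/eqP: p0; apply/mpolyP => e.
  by rewrite mcoeff0; apply/eqP; apply: contraT => /(all0 e).
(* Every exponent in the support is below [b], so [kappa], which reads exponents as base b digits,
   keeps distinct monomials distinct. *)
pose b := (msize p).+1; pose kappa (e : multinom n) := (\sum_(i < n) e i * b ^ i)%N.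
have small e i : e \in msupp p -> (e i < b)%N.
  move=> /msize_mdeg_lt ep; apply: leq_ltn_trans (leqW ep); rewrite mdegE.
  by rewrite (bigD1 i) //= leq_addr.
pose q := \sum_(e <- msupp p) mcoeff e p *: 'X^(kappa e).
have q0 : q != 0.
  apply: contraNneq (pe0) => q0; have := coef0 F (kappa e0); rewrite -q0 coef_sum.
  rewrite (bigD1_seq e0) ?mcoeff_msupp ?msupp_uniq //= coefZ coefXn eqxx mulr1.
  rewrite big_seq_cond big1 ?addr0 => [->//|e /andP[ep ee0]].
  rewrite coefZ coefXn; case: eqP => [E|_]; last by rewrite mulr0.
  case/eqP: ee0; apply/mnmP; apply: (digits_inj (b := b)) (esym E) => i; apply: small => //.
  by rewrite mcoeff_msupp.
have [t qt] : exists t : nat, ~~ root q t%:R.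
  apply/not_existsP => all0; have := max_poly_roots q0 (rs := [seq i%:R | i <- iota 0 (size q)]).
  rewrite size_map size_iota ltnn map_inj_uniq ?iota_uniq; last exact: (mulrIn (oner_neq0 F)).
  move=> H; suff : false by []; apply: H => //.
  by apply/allP => _ /mapP[t _ ->]; apply: contraT => /(all0 t).
exists (fun i => (t ^ (b ^ i))%N); move: qt; rewrite rootE horner_sum; congr (_ != 0).
rewrite mevalE; apply: eq_bigr => e _; rewrite hornerZ hornerXn; congr (_ * _).
by rewrite -prodrXr; apply: eq_bigr => i _; rewrite natrX -exprM mulnC.
Qed.

(** * The norm of an algebraic relation *)

Section RationalRelation.
Variable L : numFieldType.
Local Notation pQ h := (map_poly (ratr : rat -> L) h).

Lemma common_primitive_element (s : seq L) :
  (forall z, z \in s -> algebraicOver (ratr : rat -> L) z) ->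
  exists theta : L, algebraicOver (ratr : rat -> L) theta /\
    forall z, z \in s -> exists h : {poly rat}, z = (pQ h).[theta].
Proof.
elim: s => [|x s IH] alg; first by exists 0; split; [exact: algebraic0|].
have [|th [[p p0 pth] hs]] := IH; first by move=> z zs; apply: alg; rewrite inE zs orbT.
have [q q0 qx] := alg x (mem_head _ _).
have [n [[h1 Eth] [h2 Ex]]] := pchar0_PET p0 pth q0 qx (pchar_num _).
have algth : algebraicOver (ratr : rat -> L) th by exists p.
have algx : algebraicOver (ratr : rat -> L) x by exists q.
exists (x *+ n - th); split.
  apply: algebraic_sub => //; rewrite -mulr_natr; apply: algebraic_mul => //.
  by rewrite -(ratr_nat L n); exact: algebraic_id.
move=> z; rewrite inE => /orP[/eqP ->|/hs[h ->]]; first by exists h2.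
by exists (h \Po h1); rewrite map_comp_poly horner_comp Eth.
Qed.

(** Minimality of the size stands in for irreducibility: it is what makes multiplication by an
    element nonzero at [theta] injective. *)
Lemma minimal_annihilator (theta : L) : algebraicOver (ratr : rat -> L) theta ->
  exists mu : {poly rat}, [/\ mu != 0, (pQ mu).[theta] = 0 &
    forall u : {poly rat}, (size u < size mu)%N -> (pQ u).[theta] = 0 -> u = 0].
Proof.
case=> p p0 pth.
pose P n := `[< exists u : {poly rat}, [/\ u != 0, (pQ u).[theta] = 0 & size u = n] >].
have exP : exists n, P n by exists (size p); apply/asboolP; exists p; split=> //; exact/rootP.
have [n /asboolP[mu [mu0 muth <-]] nmin] := ex_minnP exP.
exists mu; split=> // u umu uth; apply/eqP; apply: contraLR umu => u0.
by rewrite -leqNgt; apply: nmin; apply/asboolP; exists u.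
Qed.

Section Multiplication.
Variables (theta : L) (mu : {poly rat}).
Hypothesis mu0 : mu != 0.
Hypothesis muth : (pQ mu).[theta] = 0.
Hypothesis mumin : forall u : {poly rat}, (size u < size mu)%N -> (pQ u).[theta] = 0 -> u = 0.
Local Notation d := (size mu).-1.

Definition mulmod_mx (h : {poly rat}) : 'M[rat]_d := \matrix_(i, j) (('X^i * h) %% mu)`_j.

Lemma mulmod_size_gt0 : (0 < d)%N.
Proof.
rewrite -subn1 subn_gt0 ltnNge; apply/negP => /size1_polyC E; case/eqP: mu0.
move: muth; rewrite E map_polyC hornerC => /eqP; rewrite fmorph_eq0 => /eqP ->.
by rewrite polyC0.
Qed.

Let dS : d.+1 = size mu.
Proof. by rewrite prednK // size_poly_gt0. Qed.

Let modp_theta (u : {poly rat}) : (pQ (u %% mu)).[theta] = (pQ u).[theta].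
Proof. by rewrite [in RHS](divp_eq u mu) rmorphD rmorphM hornerD hornerM muth mulr0 add0r. Qed.

Let horner_small (u : {poly rat}) : (size u <= d)%N -> (pQ u).[theta] = \sum_(j < d) ratr u`_j * theta ^+ j.
Proof.
move=> ud; rewrite (horner_coef_wide _ (_ : (size (pQ u) <= d)%N)) ?size_map_poly //.
by apply: eq_bigr => j _; rewrite coef_map.
Qed.

Lemma mulmod_mx_theta h (i : 'I_d) :
  \sum_j ratr (mulmod_mx h i j) * theta ^+ j = theta ^+ i * (pQ h).[theta].
Proof.
rewrite -[RHS](_ : (pQ ('X^i * h)).[theta] = _); last first.
  by rewrite rmorphM /= map_polyXn hornerM hornerXn.
rewrite -modp_theta horner_small; last by rewrite -ltnS dS ltn_modp.
by apply: eq_bigr => j _; rewrite mxE.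
Qed.

Lemma det_mulmod_mx h : (pQ h).[theta] != 0 -> \det (mulmod_mx h) != 0.
Proof.
apply: contraNneq => /eqP/det0P[v v0 vM].
pose u := \poly_(i < d) (if insub i is Some k then v 0 k else 0).
have uE (i : 'I_d) : u`_i = v 0 i.
  by rewrite coef_poly ltn_ord insubT //= => iP; congr (v 0 _); exact/val_inj.
have ud : (size u <= d)%N by exact: size_poly.
have uhth : (pQ u).[theta] * (pQ h).[theta] = 0.
  rewrite (horner_small ud) mulr_suml.
  transitivity (\sum_(i < d) ratr (v 0 i) * \sum_j ratr (mulmod_mx h i j) * theta ^+ j).
    by apply: eq_bigr => i _; rewrite mulmod_mx_theta uE mulrA.
  under eq_bigr do rewrite mulr_sumr.
  rewrite exchange_big big1 //= => j _.
  transitivity (ratr ((v *m mulmod_mx h) 0 j) * theta ^+ j); last by rewrite vM mxE rmorph0 mul0r.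
  by rewrite mxE rmorph_sum mulr_suml; apply: eq_bigr => i _; rewrite rmorphM mulrA.
apply: contraLR v0 => hth; rewrite negbK; apply/eqP/rowP => i; rewrite mxE -uE.
rewrite (mumin (u := u)) ?coef0 //; first by rewrite -dS ltnS.
by move/eqP: uhth; rewrite mulf_eq0 (negPf hth) orbF => /eqP.
Qed.

End Multiplication.

(* The relation is the norm of p, computed as the determinant of multiplication
   by p in the basis of powers of a common primitive element of the coefficients. *)
Lemma rational_relation n (x : 'I_n -> L) (p : mpoly n L) :
  (forall e, algebraicOver (ratr : rat -> L) (mcoeff e p)) -> p != 0 -> meval x p = 0 ->
  exists2 q : mpoly n rat, q != 0 & mmap (ratr : rat -> L) x q = 0.
Proof.
move=> palg p0 px.
have [|th [algth hth]] := @common_primitive_element [seq mcoeff e p | e <- msupp p].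
  by move=> _ /mapP[e _ ->].
have [mu [mu0 muth mumin]] := minimal_annihilator algth.
have [h hE] : {h : multinom n -> {poly rat} & forall e, e \in msupp p -> mcoeff e p = (pQ (h e)).[th]}.
  apply: (choice (P := fun e he => e \in msupp p -> mcoeff e p = (pQ he).[th])) => e.
  case: (boolP (e \in msupp p)) => [ep|_]; last by exists 0.
  by have [he ->] := hth _ (map_f _ ep); exists he.
pose d := (size mu).-1.
pose M : 'M[mpoly n rat]_d := \matrix_(i, j)
  \sum_(e <- msupp p) (mulmod_mx mu (h e) i j) *: mpolyX rat e.
exists (\det M).
(* The determinant is nonzero already at a point [y] with p(y) nonzero: there [M] becomes the matrix
   of multiplication by p(y), represented by the polynomial [H]. *)
- have [y py] := mpoly_nonzero_point p0.
  pose H := \sum_(e <- msupp p) (\prod_i (y i)%:R ^+ e i) *: h e.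
  have Hth : (pQ H).[th] != 0.
    suff -> : (pQ H).[th] = meval (fun i => (y i)%:R) p by [].
    rewrite mevalE rmorph_sum horner_sum big_seq [RHS]big_seq; apply: eq_bigr => e ep.
    rewrite -mul_polyC rmorphM /= map_polyC hornerM hornerC (hE e ep) mulrC; congr (_ * _).
    by rewrite -[LHS]/(ratr _) rmorph_prod; apply: eq_bigr => i _; rewrite rmorphXn /= ratr_nat.
  have detH := det_mulmod_mx mu0 muth mumin Hth.
  apply: contraNneq detH => det0.
  have := congr1 (meval (fun i => (y i)%:R)) det0; rewrite meval0 -det_map_mx => <-.
  apply/eqP; congr (\det _); apply/matrixP => i j; rewrite !mxE rmorph_sum /=.
  rewrite /H mulr_sumr (big_morph _ (fun u v => modpD mu u v) (mod0p mu)) coef_sum; apply: eq_bigr => e _.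
  by rewrite mevalZ mevalX mxE -scalerAr modpZl coefZ mulrC.
(* At [x], the vector of powers of [th] is an eigenvector of the matrix with eigenvalue p(x) = 0, so
   the determinant vanishes. *)
- pose E := map_mx (mmap (ratr : rat -> L) x) M.
  rewrite -det_map_mx -/E -det_tr; apply/eqP/det0P; exists (\row_j th ^+ j).
    have d0 : (0 < d)%N by exact: (mulmod_size_gt0 mu0 muth).
    by apply/rV0Pn; exists (Ordinal d0); rewrite mxE expr0 oner_neq0.
  apply/rowP => i; rewrite !mxE.
  transitivity (\sum_(e <- msupp p) (th ^+ i * (pQ (h e)).[th]) * \prod_k x k ^+ e k).
    rewrite (eq_bigr (fun j : 'I_d => \sum_(e <- msupp p)
      (ratr (mulmod_mx mu (h e) i j) * th ^+ j) * \prod_k x k ^+ e k)).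
      by rewrite exchange_big; apply: eq_bigr => e _; rewrite -mulr_suml (mulmod_mx_theta mu0).
    move=> j _; rewrite !mxE rmorph_sum /= mulr_sumr; apply: eq_bigr => e _.
    by rewrite mmapZ mmapX mulrA [th ^+ j * _]mulrC.
  transitivity (th ^+ i * meval x p); last by rewrite px mulr0.
  rewrite mevalE mulr_sumr big_seq [RHS]big_seq; apply: eq_bigr => e ep.
  by rewrite (hE e ep) mulrA.
Qed.

End RationalRelation.

(** * From the basic values to the Eta constants *)

Section RationalFreeness.
Variable R : realType.

Lemma mmap_comp_mpoly (S : comNzRingType) m k (phi : {rmorphism rat -> S}) (x : 'I_k -> S)
    (lq : m.-tuple (mpoly k rat)) (q : mpoly m rat) :
  mmap phi x (comp_mpoly lq q) = mmap phi (fun i => mmap phi x (tnth lq i)) q.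
Proof.
set y := fun i => mmap phi x (tnth lq i).
rewrite [in RHS]/mmap comp_mpolyE raddf_sum; apply: eq_bigr => e _.
rewrite /= mmapZ rmorph_prod; congr (_ * _).
by apply: eq_bigr => i _; rewrite rmorphXn.
Qed.

Lemma mmap_ratr_complex m (x : 'I_m -> R) (q : mpoly m rat) :
  mmap (ratr : rat -> R[i]) (fun i => (x i)%:C) q = (mmap (ratr : rat -> R) x q)%:C.
Proof.
rewrite /mmap rmorph_sum; apply: eq_bigr => e _.
rewrite rmorphM /= fmorph_rat rmorph_prod; congr (_ * _).
by apply: eq_bigr => i _; rewrite rmorphXn.
Qed.

Lemma basic_values_rational_free m (q : mpoly m.+1 rat) :
  mmap (ratr : rat -> R) (fun j : 'I_m.+1 => basic_value R j) q = 0 -> q = 0.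
Proof.
move=> qv; set D := msize q.
pose den : int := \prod_(e <- msupp q) denq (mcoeff e q).
have den0 : den != 0 by rewrite prodf_seq_neq0; apply/allP => e _; exact: denq_neq0.
have den_int e : den%:~R * ratr (mcoeff e q) \is a @Num.int R.
  case: (boolP (e \in msupp q)) => [eq|/memN_msupp_eq0 ->]; last by rewrite rmorph0 mulr0.
  rewrite /den (bigD1_seq e) ?msupp_uniq //= rmorphM /= mulrC mulrA rpredM ?intr_int //.
  by rewrite /ratr divfK ?intr_eq0 ?denq_neq0 ?intr_int.
pose a : 'rV[R]_#|{: bmultinom m.+1 D.+1}| := \row_i (den%:~R * ratr (mcoeff (expo_of i) q)).
have a0 : a = 0.
  apply: basic_values_free => [i|]; first by rewrite mxE; exact: den_int.
  rewrite (eq_bigr (fun i => den%:~R * (ratr (mcoeff (expo_of i) q) *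
     \prod_(j < m.+1) basic_value R j ^+ expo_of i j))); last by move=> i _; rewrite mxE; exact: (esym (mulrA _ _ _)).
  rewrite -mulr_sumr; move: qv; rewrite (mmapE D.+1) ?leqnSn // => qv.
  rewrite (reindex _ (onW_bij _ (enum_val_bij (bmultinom m.+1 D.+1)))) /= in qv.
  by rewrite qv mulr0.
apply/mpolyP => e; rewrite mcoeff0; case: (boolP (e \in msupp q)) => [eq|/memN_msupp_eq0//].
have [i <-] := @expo_ofP m D e (ltnW (msize_mdeg_lt eq)).
move/rowP/(_ i): a0; rewrite !mxE => /eqP.
by rewrite mulf_eq0 intr_eq0 (negPf den0) fmorph_eq0 => /eqP.
Qed.

Lemma eta_rational_free m (f : 'I_m -> nat) (q : mpoly m rat) : injective f ->
  mmap (ratr : rat -> R) (fun i => eta_const R (f i)) q = 0 -> q = 0.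
Proof.
move=> finj qv; pose M := (\max_i f i)%N.
have fM i : (f i < M.+1)%N by rewrite ltnS leq_bigmax.
pose var i : 'I_M.+1 := Ordinal (fM i).
pose g i : mpoly M.+1 rat := (f i)`!%:R *: ((f i == 0%N)%:R - mpolyX rat (mnm1 (var i))).
pose lq := [tuple g i | i < m].
have comp0 : comp_mpoly lq q = 0.
  apply: basic_values_rational_free; rewrite mmap_comp_mpoly -[RHS]qv.
  congr (mmap _ _ q); apply/funext => i.
  by rewrite tnth_mktuple /g mmapZ mmapB mmapX mmap1U /= !rmorph_nat eta_constE.
apply/eqP; apply: contraT => /mpoly_nonzero_point[y qy].
(* [Y] inverts the affine substitution [g]: evaluating [comp_mpoly lq q] at [Y] gives the value of
   [q] at [y]. Injectivity of [f] makes the picked index unique. *)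
pose Y (k : 'I_M.+1) : rat := if [pick i | f i == k] is Some i then
   (f i == 0%N)%:R - (y i)%:R / (f i)`!%:R else 0.
case/negP: qy; rewrite -(meval0 Y) -comp0 comp_mpoly_meval.
apply/eqP/meval_eq => i; rewrite tnth_mktuple /g mevalZ mevalB mevalXU rmorph_nat /Y.
case: pickP => [k /eqP /finj ->|/(_ i)]; last by rewrite eqxx.
by rewrite opprB addrCA subrr addr0 mulrC divfK ?natr_fact_neq0.
Qed.

End RationalFreeness.

Theorem theorem2 (R : realType) :
  algebraically_independent (@Qbar R) (fun n : nat => (eta_const R n)%:C)
  /\ (forall n : nat, transcendental (eta_const R n)%:C).
Proof.
have indep : algebraically_independent (@Qbar R) (fun n : nat => (eta_const R n)%:C).
  move=> m f finj p palg pv; apply/eqP; apply: contraT => p0.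
  have [q q0] := rational_relation palg p0 pv.
  rewrite /= mmap_ratr_complex => /eqP; rewrite fmorph_eq0 => /eqP /(eta_rational_free finj) q00.
  by rewrite q00 eqxx in q0.
split=> // n etan.
(* The family of one element is tested on the polynomial X - z, whose coefficients are algebraic as
   soon as [z] is. *)
pose z := (eta_const R n)%:C; pose p : mpoly 1 R[i] := mpolyX _ (mnm1 ord0) - mpolyC 1 z.
have : p = 0.
  apply: (indep 1%N (fun=> n)) => [i k _|e|]; first by rewrite (ord1 i) (ord1 k).
    rewrite /Qbar /= mcoeffB mcoeffX mcoeffC; apply: algebraic_sub.
      by case: (_ == _); [exact: algebraic1|exact: algebraic0].
    by apply: algebraic_mul => //; case: (_ == _); [exact: algebraic1|exact: algebraic0].
  by rewrite mevalB mevalX mevalC big_ord1 mnm1E expr1 subrr.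
move/(congr1 (mcoeff (mnm1 ord0))); rewrite mcoeffB mcoeffX mcoeffC mcoeff0 eqxx mnm1_eq0.
by rewrite mulr0 subr0 => /eqP; rewrite oner_eq0.
Qed.
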